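(* Let $D=(V(D),E(D),w)$ be a weighted oriented graph with underlying simple graph $G$. If the edge ideal $I(D)$ is componentwise linear, then the complement $G^c$ is chordal.
   Context: A weighted oriented graph $D=(V(D),E(D),w)$ consists of a finite vertex set $V(D)=\{x_1,\dots,x_n\}$, a set $E(D)$ of directed edges $(x,y)$ (from $x$ towards $y$) between distinct vertices, obtained by orienting each edge of a simple graph in exactly one direction, and a weight function $w:V(D)\to\{1,2,3,\dots\}$. Its underlying simple graph $G$ has $V(G)=V(D)$ and $E(G)=\{\{x,y\}: (x,y)\in E(D)\text{ or }(y,x)\in E(D)\}$. Identifying vertices with variables of $R=\mathbb{K}[x_1,\dots,x_n]$, $\mathbb{K}$ a field, the edge ideal is $I(D)=(x_ix_j^{w(x_j)} : (x_i,x_j)\in E(D))\subseteq R$. If a vertex is a source (has no incoming edge), its weight does not affect $I(D)$ and by convention is taken to be $1$. For a homogeneous ideal $I\subseteq R$ and $d\ge 0$, $I_{\langle d\rangle}$ denotes the ideal generated by all homogeneous elements of degree $d$ in $I$. $I$ is componentwise linear if for each $d\geq 0$ the ideal $I_{\langle d\rangle}$ has a $d$-linear resolution over $R$, i.e. is zero or satisfies $\operatorname{reg}(I_{\langle d\rangle})=d$, where $\operatorname{reg}$ is Castelnuovo–Mumford regularity. A simple graph is chordal if it has no induced cycle of length greater than three. $G^c$ is the complement graph of $G$. *)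

(* Defs.v *)
From mathcomp Require Import all_boot all_algebra.
From mathcomp Require Import mpoly.

Set Implicit Arguments.
Unset Strict Implicit.
Unset Printing Implicit Defensive.

Import GRing.Theory.
Local Open Scope ring_scope.

Record sgraph (V : finType) := SGraph {
  adj : rel V;
  adj_sym : ssrbool.symmetric adj;
  adj_irr : irreflexive adj
}.

Section Complement.
Variables (V : finType) (G : sgraph V).

Definition compl_adj : rel V := fun x y => (x != y) && ~~ adj G x y.

Fact compl_adj_sym : ssrbool.symmetric compl_adj.
Proof. by move=> x y; rewrite /compl_adj eq_sym adj_sym. Qed.

Fact compl_adj_irr : irreflexive compl_adj.
Proof. by move=> x; rewrite /compl_adj eqxx. Qed.

Definition compl_graph : sgraph V := SGraph compl_adj_sym compl_adj_irr.

End Complement.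

(* ordS is the cyclic successor on 'I_k. *)
Definition induced_cycle (V : finType) (G : sgraph V) (k : nat)
    (c : 'I_k -> V) : Prop :=
  injective c /\
  forall i j, adj G (c i) (c j) = (j == ordS i) || (i == ordS j).

Definition chordal (V : finType) (G : sgraph V) : Prop :=
  forall (k : nat) (c : 'I_k -> V), (3 < k)%N -> ~ induced_cycle G c.

Record wograph (n : nat) := WOGraph {
  arc : rel 'I_n;
  arc_irr : irreflexive arc;
  arc_asym : forall x y, arc x y -> ~~ arc y x;
  weight : 'I_n -> nat;
  weight_gt0 : forall x, (0 < weight x)%N;
  weight_source : forall x, (forall y, ~~ arc y x) -> weight x = 1%N
}.

Section Underlying.
Variables (n : nat) (D : wograph n).

Definition und_adj : rel 'I_n := fun x y => arc D x y || arc D y x.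

Fact und_adj_sym : ssrbool.symmetric und_adj.
Proof. by move=> x y; rewrite /und_adj orbC. Qed.

Fact und_adj_irr : irreflexive und_adj.
Proof. by move=> x; rewrite /und_adj arc_irr. Qed.

Definition underlying : sgraph 'I_n := SGraph und_adj_sym und_adj_irr.

End Underlying.

Definition ideal_gen (R : comNzRingType) (S : R -> Prop) (p : R) : Prop :=
  exists s : seq (R * R),
    (forall x, x \in s -> S x.2) /\ p = \sum_(x <- s) x.1 * x.2.

Definition edge_ideal (K : fieldType) (n : nat) (D : wograph n) :
    {mpoly K[n]} -> Prop :=
  ideal_gen (fun p : {mpoly K[n]} =>
    exists i j : 'I_n, arc D i j /\ p = 'X_i * 'X_j ^+ weight D j).

Section Regularity.
Variables (K : fieldType) (n : nat).
Implicit Type I : {mpoly K[n]} -> Prop.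

(* A graded free resolution ... -> F_1 -> F_0 -> I -> 0 of a homogeneous ideal
   I, where F_i is the direct sum of the R(- shift i a) for a < rk i. Elements
   of F_i are row vectors, and the maps act by multiplication on the right.
   Shifts are taken in nat: all the degrees occurring in a minimal resolution
   of an ideal of R are nonnegative. *)
Record graded_resolution I := GradedResolution {
  rk : nat -> nat;
  shift : forall i, 'I_(rk i) -> nat;
  aug : 'cV[{mpoly K[n]}]_(rk 0);
  diff : forall i, 'M[{mpoly K[n]}]_(rk i.+1, rk i);
  aug_homog : forall a, aug a 0 \is (shift a).-homog;
  diff_homog : forall i a b, diff i a b != 0 ->
    (shift b <= shift a)%N /\ diff i a b \is (shift a - shift b).-homog;
  aug_image : forall p : {mpoly K[n]},
    I p <-> exists u : 'rV_(rk 0), p = (u *m aug) 0 0;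
  exact_at_0 : forall v : 'rV_(rk 0),
    v *m aug = 0 <-> exists u : 'rV_(rk 1), v = u *m diff 0;
  exact_at_S : forall i (v : 'rV_(rk i.+1)),
    v *m diff i = 0 <-> exists u : 'rV_(rk i.+2), v = u *m diff i.+1
}.

(* Every differential maps F_{i+1} into (x_1, ..., x_n) F_i. *)
Definition minimal_resolution I (F : graded_resolution I) : Prop :=
  forall i a b, (diff F i a b)@_0%MM = 0.

Definition betti I (F : graded_resolution I) (i j : nat) : nat :=
  #|[set a : 'I_(rk F i) | shift a == j]|.

(* reg I = r, i.e. r is the maximum of the j - i with beta_{i,j}(I) != 0. As
   minimal graded free resolutions are unique up to isomorphism, the choice of
   F is immaterial. There is no such r when I = 0. *)
Definition has_regularity I (r : nat) : Prop :=
  exists F : graded_resolution I,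
    [/\ minimal_resolution F,
        forall i j, betti F i j <> 0%N -> (j <= r + i)%N
      & exists i, betti F i (r + i) <> 0%N].

Definition degree_component_ideal I (d : nat) : {mpoly K[n]} -> Prop :=
  ideal_gen (fun p : {mpoly K[n]} => I p /\ p \is d.-homog).

Definition has_linear_resolution I (d : nat) : Prop :=
  (forall p, I p -> p = 0) \/ has_regularity I d.

Definition componentwise_linear I : Prop :=
  forall d : nat, has_linear_resolution (degree_component_ideal I d) d.

End Regularity.

(* Main.v *)
From mathcomp Require Import all_boot all_algebra zify ring.
From mathcomp Require Import mpoly.
Require Import Defs.

(** Why the theorem holds.

    Suppose I = I(D) is componentwise linear and G^c has a hole C, i.e. an
    induced cycle of length at least four.  Let v be a vertex of C whose
    weight t is maximal among the vertices of C that receive an arc from C.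
    Every arc inside C then contributes its generator to the component
    J = I_<t+1>, and the contradiction comes from the linearity of the
    resolution of J and of I_<2>.

    Algebra.  If J has a d-linear resolution F, then the Koszul homology of J
    vanishes off the linear strand: a Koszul p-cycle with values in J, of
    coefficient degree larger than d, is a boundary of a chain with values in J
    ([linear_koszul]).  This is the balancing of Tor, done by hand: the cycle
    is lifted through F_0, F_1, and so on until the Koszul degree is 0, where
    the degree bound on the generators of F forces the lift into the ideal of
    the variables; then one descends by exactness of the Koszul complex of the
    polynomial ring ([resolution_koszul]).  As J is a monomial ideal, the
    result is read off coefficient by coefficient, and it is used twice.

    - [koszul_cycle] is a form of the easy half of Froeberg's theorem.  Call a
      set of vertices a face when the monomial attached to it is not in J.
      Given a closed walk through distinct vertices whose consecutive pairs
      are faces, each of these pairs lies in a triangle that is a face: else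
      the cochain that is 1 on that pair and 0 on the other pairs would be a
      cocycle whose sum along the closed walk is not 0.
    - [linear_syzygies] concerns first syzygies.  Suppose that the monomials
      of J dividing a monomial m0 fall into two families, and that common
      multiples of the two families have degree at least d + 2.  Then no
      common multiple divides m0, since a minimal one would carry a nonlinear
      syzygy.

    Combinatorics.  Call an edge of G light when its head has weight 1, and a
    pair of distinct vertices heavy when it is not a light edge; heavy pairs
    contain the edges of G^c.  Two facts come out of the algebra: the heavy
    graph behaves like a chordal graph ([heavy_chord]), and an arc into a
    vertex v of weight at least 2, together with an arc whose head is another
    vertex of at most the same weight, always spans a light edge
    ([light_arc]).

    Write C as v, p, s, q in cyclic order.  Since the heavy graph is chordal,
    the heavy neighbours of v along C form a heavy walk from p to q
    ([heavy_filter]).  The inner vertices of this walk are in-neighbours of v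
    or out-neighbours of weight at least 2; by [light_arc] no heavy pair joins
    the two kinds, so they all are in-neighbours of v.  If the pair p, q is
    heavy, chordality produces an in-neighbour of v that is heavy to both p
    and q, against [light_arc].  If it is light, then [heavy_cycle] (the
    previous closed walk argument with the exponent of v raised to t) applies
    to v and this walk. *)

Set Implicit Arguments.
Unset Strict Implicit.
Unset Printing Implicit Defensive.

Import GRing.Theory.
Local Open Scope ring_scope.

(** * The Koszul complex of a polynomial ring *)

Section Koszul.
Variables (n : nat) (K : fieldType).
Local Notation R := {mpoly K[n]}.
Local Notation chain := ({set 'I_n} -> R).
Implicit Types (f g : chain) (S : {set 'I_n}) (m : 'X_{1..n}) (s : 'I_n).

Definition ksign (A : comNzRingType) s S : A := (-1) ^+ #|[set j in S | (j < s)%N]|.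

(** Koszul chains are stored as functions on sets of variables: [f S] is the
    coefficient of the basis element e_S, in all Koszul degrees at once. *)
Definition kdiff f S : R :=
  \sum_(s | s \notin S) ksign R s S * ('X_s * f (s |: S)).

Lemma ksignU (A : comNzRingType) s s' S : s' \notin S ->
  ksign A s (s' |: S) = (-1) ^+ (s' < s)%N * ksign A s S.
Proof.
move=> s'S; rewrite /ksign -exprD; congr (_ ^+ _).
have -> : [set j in s' |: S | (j < s)%N]
          = (if (s' < s)%N then [set s'] else set0)
            :|: [set j in S | (j < s)%N].
  apply/setP=> j; case: ifP => h; rewrite !inE.
    by have [->|] := eqVneq j s'; rewrite ?h.
  by have [->|] := eqVneq j s'; rewrite ?h // (negbTE s'S).
rewrite cardsU; case: ifP => h /=; last by rewrite set0I !cards0 subn0.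
rewrite (_ : _ :&: _ = set0) ?cards0 ?cards1 ?subn0 //.
apply/setP=> j; rewrite !inE; apply/negbTE; apply/negP.
by case/and3P=> /eqP ->; rewrite (negbTE s'S).
Qed.

Lemma ksignK (A : comNzRingType) s S : ksign A s S * ksign A s S = 1.
Proof. by rewrite -expr2 sqrr_sign. Qed.

Lemma ksign_swap (A : comNzRingType) s s' S :
  s \notin S -> s' \notin S -> s != s' ->
  ksign A s S * ksign A s' (s |: S) = - (ksign A s' S * ksign A s (s' |: S)).
Proof.
move=> sS s'S ss'; rewrite !ksignU //.
have [lt|gt|/val_inj e] := ltngtP s s'; last by rewrite e eqxx in ss'.
  by rewrite expr1 expr0; ring.
by rewrite expr1 expr0; ring.
Qed.

Lemma eq_kdiff f g : f =1 g -> kdiff f =1 kdiff g.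
Proof. by move=> e S; apply: eq_bigr => s _; rewrite e. Qed.

Lemma kdiffB f g S :
  kdiff (fun T => f T - g T) S = kdiff f S - kdiff g S.
Proof.
by rewrite /kdiff -sumrB; apply: eq_bigr => s _; rewrite !mulrBr.
Qed.

(** The terms of the double sum are paired by exchanging the two added
    vertices.  Splitting by order makes them cancel in pairs, which also works
    in characteristic 2. *)
Lemma kdiff_kdiff f S : kdiff (kdiff f) S = 0.
Proof.
pose F s s' := ksign R s S * ksign R s' (s |: S)
               * ('X_s * 'X_s' * f (s' |: (s |: S))).
have -> : kdiff (kdiff f) S =
  \sum_(s | s \notin S) \sum_(s' | (s' \notin S) && (s != s')) F s s'.
  apply: eq_bigr => s sS; rewrite !mulr_sumr; apply: eq_big => s'.
    by rewrite !inE negb_or andbC eq_sym.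
  by move=> _; rewrite /F; ring.
have antiF s s' : s \notin S -> s' \notin S -> s != s' -> F s s' = - F s' s.
  move=> sS s'S ss'; rewrite /F ksign_swap // setUCA mulNr.
  by rewrite ['X_s * 'X_s']mulrC.
rewrite (eq_bigr (fun s : 'I_n =>
   \sum_(s' | (s' \notin S) && (s < s')%N) F s s' +
   \sum_(s' | (s' \notin S) && (s' < s)%N) F s s')); last first.
  move=> s sS; rewrite (bigID (fun s' : 'I_n => (s < s')%N)) /=.
  congr (_ + _); apply: eq_bigl => s'; rewrite -val_eqE neq_ltn -andbA;
    congr andb; by case: ltngtP.
rewrite big_split /= [X in _ + X](exchange_big_dep (fun s => s \notin S)) /=;
  last by move=> s s' _ /andP[].
rewrite -big_split big1 //= => s sS; apply/eqP.
rewrite addr_eq0 -sumrN; apply/eqP; apply: eq_big => s'.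
  by rewrite sS.
by case/andP=> s'S lt; rewrite antiF // -val_eqE neq_ltn lt.
Qed.

Lemma mnm1_le s m : (U_(s) <= m)%MM = (0 < m s)%N.
Proof.
apply/mnm_lepP/idP => [/(_ s)|h j]; first by rewrite mnm1E eqxx.
by rewrite mnm1E; case: eqP => // <-.
Qed.

Lemma mcoeffXM s (p : R) m :
  ('X_s * p)@_m = if (0 < m s)%N then p@_(m - U_(s))%MM else 0.
Proof.
rewrite -commr_mpolyX; case: ifP => h.
  have le_sm : (U_(s) <= m)%MM.
    by rewrite mnm1_le.
  by rewrite -{1}(submK le_sm) addmC mcoeffMX.
apply/eqP; rewrite mcoeff_eq0; apply/negP; rewrite (perm_mem (msuppMX _ _)).
by case/mapP=> m' _ e; rewrite e mnmDE mnm1E eqxx in h.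
Qed.

Lemma mcoeff_ksign s S (p : R) m :
  (ksign R s S * p)@_m = ksign K s S * p@_m.
Proof.
rewrite /ksign -signr_odd -[in RHS]signr_odd.
by case: odd; rewrite ?expr0 ?expr1 ?mul1r // !mulN1r mcoeffN.
Qed.


Lemma mcoeff_kdiff f S m :
  (kdiff f S)@_m = \sum_(s | (s \notin S) && (0 < m s)%N)
                     ksign K s S * (f (s |: S))@_(m - U_(s))%MM.
Proof.
rewrite /kdiff raddf_sum big_mkcondr /=; apply: eq_bigr => s _.
by rewrite mcoeff_ksign mcoeffXM; case: ifP; rewrite ?mulr0.
Qed.

Lemma mcoeff_kdiff_neq0 f S m : (kdiff f S)@_m != 0 ->
  exists s, [/\ s \notin S, (0 < m s)%N & (f (s |: S))@_(m - U_(s))%MM != 0].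
Proof.
rewrite mcoeff_kdiff => nz.
suff /exists_inP[s /andP[sS ms] nzs] :
    [exists (s | (s \notin S) && (0 < m s)%N), (f (s |: S))@_(m - U_(s))%MM != 0].
  by exists s.
apply: contraR nz; rewrite negb_exists_in => /forall_inP h.
by rewrite big1 // => s /h; rewrite negbK => /eqP ->; rewrite mulr0.
Qed.

(** The contracting homotopy [khom] moves the first variable occurring in
    x^m e_S from the monomial to the exterior part, and kills x^m e_S when that
    variable already is in S.  It is linear over the field only, needs no
    hypothesis on the characteristic, and fails to contract only the constants
    in Koszul degree 0. *)
Definition kfirst s m S :=
  [forall j : 'I_n, (j < s)%N ==> (j \notin S) && (m j == 0%N)].

Lemma kfirstP s m S :
  reflect (forall j : 'I_n, (j < s)%N -> j \notin S /\ m j = 0%N)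
          (kfirst s m S).
Proof.
apply: (iffP forallP) => h j; first by move=> lt; move: (h j); rewrite lt /=;
  case/andP=> ? /eqP.
by apply/implyP=> /h[-> ->].
Qed.

Lemma kfirst_exists m S : (m, S) != (0%MM, set0) ->
  exists2 s, kfirst s m S & (s \in S) || (0 < m s)%N.
Proof.
move=> ne; pose P (s : 'I_n) := (s \in S) || (0 < m s)%N.
have [s Ps] : exists s, P s.
  apply/existsP; apply: contraR ne => /existsPn h; rewrite xpair_eqE.
  apply/andP; split; last first.
    by apply/eqP/setP=> j; move: (h j); rewrite inE negb_or => /andP[/negbTE].
  apply/eqP/mnmP=> j; move: (h j); rewrite negb_or mnm0E => /andP[_].
  by rewrite -leqNgt leqn0 => /eqP.
case: (@arg_minnP _ s P (fun j => val j) Ps) => s0 Ps0 min0.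
exists s0 => //; apply/kfirstP=> j lt.
have /negP : ~ P j by move=> /min0; rewrite leqNgt lt.
by rewrite negb_or -leqNgt leqn0 => /andP[-> /eqP].
Qed.

Lemma kfirst_uniq s s' m S : kfirst s m S -> kfirst s' m S ->
  (s \in S) || (0 < m s)%N -> (s' \in S) || (0 < m s')%N -> s = s'.
Proof.
move=> /kfirstP h /kfirstP h' i i'; apply: val_inj.
by case: (ltngtP s s') => // [/h'|/h] [nS m0];
  [move: i|move: i']; rewrite m0 (negbTE nS).
Qed.

Definition khom f S : R :=
  \sum_(s in S) \sum_(m <- msupp (f (S :\ s)) | (0 < m s)%N && kfirst s m S)
    (f (S :\ s))@_m *: 'X_[m - U_(s)].

Lemma mcoeff_khom f S m :
  (khom f S)@_m = \sum_(s in S | kfirst s m S) (f (S :\ s))@_(m + U_(s))%MM.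
Proof.
rewrite /khom raddf_sum big_mkcondr /=; apply: eq_bigr => s _.
have fE : kfirst s (m + U_(s))%MM S = kfirst s m S.
  by apply: eq_forallb => j; case: ltnP => //= lt;
    rewrite mnmDE mnm1E -val_eqE (gtn_eqF lt) addn0.
rewrite raddf_sum /= big_mkcond.
have coefE m' : (0 < m' s)%N && kfirst s m' S ->
    ('X_[m' - U_(s)] : R)@_m = (m' == m + U_(s))%MM%:R.
  case/andP=> pos _; rewrite mcoeffX; congr (nat_of_bool _)%:R.
  have le_s : (U_(s) <= m')%MM by rewrite mnm1_le.
  by apply/eqP/eqP => [<-|->]; rewrite ?submK ?addmK.
case: ifP => firstm; last first.
  rewrite big1 // => m' _; case: ifP => // cnd.
  rewrite mcoeffZ coefE //; case: eqP => [e|]; last by rewrite mulr0.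
  by case/andP: cnd => _; rewrite e fE firstm.
have [inS|notS] := boolP ((m + U_(s))%MM \in msupp (f (S :\ s))); last first.
  rewrite (memN_msupp_eq0 notS) big1_seq // => m' /= m'S.
  case: ifP => // cnd; rewrite mcoeffZ coefE //.
  by case: eqP => [e|]; rewrite ?mulr0 //; rewrite e (negbTE notS) in m'S.
rewrite (bigD1_seq _ inS (msupp_uniq _)) /= big1 ?addr0.
  by rewrite mnmDE mnm1E eqxx addn1 fE firstm /= mcoeffZ mcoeffX addmK eqxx mulr1.
move=> m' /negbTE ne; case: ifP => // cnd.
by rewrite mcoeffZ coefE // ne mulr0.
Qed.

Lemma khom0 f : khom f set0 = 0.
Proof. by rewrite /khom big1 // => s; rewrite inE. Qed.

Lemma mcoeff_khom_first f S m s :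
  kfirst s m S -> (s \in S) || (0 < m s)%N ->
  (khom f S)@_m = if s \in S then (f (S :\ s))@_(m + U_(s))%MM else 0.
Proof.
move=> first nz; rewrite mcoeff_khom; case: ifP => sS.
  rewrite (bigD1 s) ?sS //= big1 ?addr0 // => s' /andP[/andP[s'S first'] ne].
  by rewrite (kfirst_uniq first' first) ?s'S ?eqxx in ne.
rewrite big1 // => s' /andP[s'S first'].
by move: sS; rewrite -(kfirst_uniq first' first) ?s'S.
Qed.

(** Evaluating the identity d h + h d = id on a cycle.  The primitive vanishes
    at the empty set, which later keeps lifts free of constant terms. *)
Lemma koszul_exact f : kdiff f =1 (fun _ => 0) -> (f set0)@_0%MM = 0 ->
  exists2 g, f =1 kdiff g & g set0 = 0.
Proof.
move=> df0 f00; exists (khom f); last exact: khom0.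
move=> S; apply/mpolyP=> m; rewrite mcoeff_kdiff.
have [[-> ->]|ne] := eqVneq (m, S) (0%MM, set0).
  by rewrite f00 big1 // => s; rewrite mnm0E andbF.
have [u first nz] := kfirst_exists ne.
have step s : s \notin S -> (0 < m s)%N ->
    (khom f (s |: S))@_(m - U_(s))%MM =
    if u \in s |: S then (f ((s |: S) :\ u))@_(m - U_(s) + U_(u))%MM else 0.
  move=> sS ms; apply: mcoeff_khom_first.
    apply/kfirstP=> j lt; move/kfirstP: first => /(_ j lt)[jS mj].
    rewrite mnmBE mj; split; last by [].
    by rewrite !inE negb_or jS andbT; apply/eqP=> e; rewrite -e mj in ms.
  rewrite !inE mnmBE mnm1E; have [//|_] := eqVneq u s.
  by rewrite subn0.
have [uS|uS] := boolP (u \in S); last first.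
  have mu : (0 < m u)%N by move: nz; rewrite (negbTE uS).
  rewrite (bigD1 u) ?uS ?mu //= big1 ?addr0.
    rewrite step // !inE eqxx /= setU1K // submK; last first.
      by rewrite mnm1_le.
    rewrite /ksign (_ : [set j in S | (j < u)%N] = set0) ?cards0 ?mul1r //.
    apply/setP=> j; rewrite !inE; apply/negbTE/negP => /andP[jS lt].
    by move/kfirstP: first => /(_ j lt)[]; rewrite jS.
  move=> s /andP[/andP[sS ms] ne']; rewrite step // !inE eq_sym (negbTE ne').
  by rewrite (negbTE uS) mulr0.
move: (df0 (S :\ u)) => /(congr1 (mcoeff (m + U_(u))%MM)).
rewrite mcoeff0 mcoeff_kdiff (bigD1 u) /=; last first.
  by rewrite !inE eqxx /= mnmDE mnm1E eqxx addn1.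
have first0 : [set j in S :\ u | (j < u)%N] = set0.
  apply/setP=> j; rewrite !inE; apply/negbTE/negP => /andP[/andP[_ jS] lt].
  by move/kfirstP: first => /(_ j lt)[]; rewrite jS.
rewrite {1}/ksign first0 cards0 mul1r setD1K // addmK => /eqP.
rewrite addr_eq0 => /eqP ->; rewrite -sumrN; apply: eq_big => s.
  rewrite !inE mnmDE mnm1E; have [->|ne'] := eqVneq s u; first by rewrite uS ?eqxx !andbF.
  by rewrite addn0 andbT.
case/andP=> /andP[]; rewrite !inE => sSu ms ne'.
have {}sSu : s \notin S by move: sSu; rewrite ne'.
have {}ms : (0 < m s)%N.
  by move: ms; rewrite mnmDE mnm1E eq_sym (negbTE ne') addn0.
rewrite step // !inE uS orbT.
have -> : (s |: S) :\ u = s |: (S :\ u).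
  apply/setP=> j; rewrite !inE; have [->|] := eqVneq j s; last by [].
  by rewrite ne'.
have -> : ksign K s S = - ksign K s (S :\ u).
  rewrite -{1}(setD1K uS) ksignU ?setD11 //.
  have lt : (u < s)%N.
    rewrite ltnNge; apply/negP=> le.
    have lt : (s < u)%N by rewrite ltn_neqAle le val_eqE ne'.
    by move/kfirstP: first => /(_ s lt)[_ m0]; rewrite m0 in ms.
  by rewrite lt expr1 mulN1r.
rewrite mulNr; congr (- (_ * _)); congr (_@__); apply/mnmP=> j.
rewrite !(mnmDE, mnmBE, mnm1E); have [e|_] := eqVneq s j; last by lia.
by rewrite e in ms; lia.
Qed.

(** * Graded resolutions and Koszul cycles *)

Lemma mcoeff_restr (P : pred 'X_{1..n}) (p : R) k :
  (\sum_(m <- msupp p | P m) p@_m *: 'X_[m])@_k = if P k then p@_k else 0.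
Proof.
rewrite raddf_sum /= big_mkcond.
have [kS|kS] := boolP (k \in msupp p); last first.
  rewrite (memN_msupp_eq0 kS) if_same big1_seq // => m /= mS.
  rewrite mcoeffZ mcoeffX; have [e|_] := eqVneq m k; last by rewrite mulr0 if_same.
  by rewrite e (negbTE kS) in mS.
rewrite (bigD1_seq _ kS (msupp_uniq _)) /= big1 ?addr0.
  by rewrite mcoeffZ mcoeffX eqxx mulr1.
by move=> m ne; rewrite mcoeffZ mcoeffX (negbTE ne) mulr0 if_same.
Qed.

Definition vhomog r (d : 'I_r -> nat) (e : nat) (v : 'rV[R]_r) :=
  forall a k, (v 0 a)@_k != 0 -> (mdeg k + d a)%N = e.

(** A homogeneous vector in the image of a homogeneous matrix has a homogeneous
    preimage: discard the terms of the wrong degree. *)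
Lemma vhomog_lift r t (A : 'M[R]_(r, t)) (da : 'I_r -> nat) (db : 'I_t -> nat) :
  (forall a b k, (A a b)@_k != 0 -> (mdeg k + db b)%N = da a) ->
  forall u e, vhomog db e (u *m A) ->
  exists2 u', vhomog da e u' & u' *m A = u *m A.
Proof.
move=> hA u e hv.
pose P a m := (mdeg m + da a)%N == e.
pose u' := \row_a \sum_(m <- msupp (u 0 a) | P a m) (u 0 a)@_m *: 'X_[m] : 'rV[R]_r.
have u'E a k : (u' 0 a)@_k = if P a k then (u 0 a)@_k else 0.
  by rewrite mxE mcoeff_restr.
exists u'.
  by move=> a k; rewrite u'E /P; case: (_ =P e) => //; rewrite eqxx.
apply/rowP=> b; apply/mpolyP=> m.
have [dm|dm] := eqVneq (mdeg m + db b)%N e; last first.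
  have /eqP -> : ((u *m A) 0 b)@_m == 0.
    by apply: contraR dm => /hv ->.
  rewrite mxE raddf_sum big1 //= => a _; rewrite mcoeffM big1 // => -[k1 k2] /= /eqP mE.
  rewrite u'E /P; case: eqP => [d1|]; last by rewrite mul0r.
  have [->|/hA d2] := eqVneq (A a b)@_k2 0; first by rewrite mulr0.
  have dE : mdeg m = (mdeg k1 + mdeg k2)%N by rewrite {1}mE mdegD.
  by case/eqP: dm; rewrite dE -addnA d2.
rewrite !mxE !raddf_sum /=; apply: eq_bigr => a _; rewrite !mcoeffM.
apply: eq_bigr => -[k1 k2] /= /eqP mE; rewrite u'E /P.
case: eqP => // d1; have [->|/hA d2] := eqVneq (A a b)@_k2 0.
  by rewrite !mulr0.
have dE : mdeg m = (mdeg k1 + mdeg k2)%N by rewrite {1}mE mdegD.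
by case: d1; rewrite -d2 addnA; rewrite -dm; congr (_ + _)%N.
Qed.

Definition vdiff r (z : {set 'I_n} -> 'rV[R]_r) S : 'rV[R]_r :=
  \row_a kdiff (fun T => z T 0 a) S.

Lemma eq_vdiff r (z z' : {set 'I_n} -> 'rV[R]_r) :
  z =1 z' -> vdiff z =1 vdiff z'.
Proof. by move=> e S; apply/rowP=> a; rewrite !mxE; apply: eq_kdiff => T; rewrite e. Qed.

Lemma vdiff_vdiff r (z : {set 'I_n} -> 'rV[R]_r) S : vdiff (vdiff z) S = 0.
Proof.
apply/rowP=> a; rewrite !mxE -(kdiff_kdiff (fun T => z T 0 a) S).
by apply: eq_kdiff => T; rewrite mxE.
Qed.

Lemma vdiffB r (z z' : {set 'I_n} -> 'rV[R]_r) S :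
  vdiff (fun T => z T - z' T) S = vdiff z S - vdiff z' S.
Proof. by apply/rowP=> a; rewrite !mxE -kdiffB; apply: eq_kdiff => T; rewrite !mxE. Qed.

Lemma vdiffM r t (A : 'M[R]_(r, t)) (z : {set 'I_n} -> 'rV[R]_r) S :
  vdiff (fun T => z T *m A) S = vdiff z S *m A.
Proof.
apply/rowP=> b; rewrite !mxE /kdiff.
under [RHS]eq_bigr do rewrite mxE mulr_suml.
rewrite exchange_big; apply: eq_bigr => s' _ /=; rewrite mxE !mulr_sumr.
by apply: eq_bigr => a _; rewrite !mulrA.
Qed.

Lemma kdiff_homog c e f :
  (forall S k, (f S)@_k != 0 -> (mdeg k + c)%N = e) ->
  forall S k, (kdiff f S)@_k != 0 -> (mdeg k + c)%N = e.+1.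
Proof.
move=> hf S k /mcoeff_kdiff_neq0[s [_ ks nzs]].
rewrite -(hf _ _ nzs) -addSn; congr (_ + _)%N.
have le_s : (U_(s) <= k)%MM by rewrite mnm1_le.
by rewrite -{1}(submK le_s) mdegD mdeg1 addn1.
Qed.

Lemma vdiff_homog r (d : 'I_r -> nat) e (z : {set 'I_n} -> 'rV[R]_r) :
  (forall S, vhomog d e (z S)) -> forall S, vhomog d e.+1 (vdiff z S).
Proof.
move=> hz S a k; rewrite mxE.
by apply: (@kdiff_homog _ _ (fun T => z T 0 a)) => T k'; apply: hz.
Qed.

Lemma vkoszul_exact r (z : {set 'I_n} -> 'rV[R]_r) :
  vdiff z =1 (fun _ => 0) -> (forall a, (z set0 0 a)@_0%MM = 0) ->
  exists2 y, z =1 vdiff y & y set0 = 0.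
Proof.
move=> dz z0.
have /fin_all_exists [g gE] a : exists g : chain,
    (forall S, z S 0 a = kdiff g S) /\ g set0 = 0.
  have [||g gE g0] := @koszul_exact (fun T => z T 0 a); last by exists g.
    by move=> S; move/rowP: (dz S) => /(_ a); rewrite !mxE.
  exact: z0.
exists (fun S => \row_a g a S).
  move=> S; apply/rowP=> a; rewrite mxE (gE a).1.
  by apply: eq_kdiff => T; rewrite mxE.
by apply/rowP=> a; rewrite !mxE (gE a).2.
Qed.

Section Resolution.
Variables (J : R -> Prop) (F : graded_resolution J).

Definition cycles q : 'rV[R]_(rk F q) -> Prop :=
  match q with
  | 0 => fun v => v *m aug F = 0
  | q'.+1 => fun v => v *m diff F q' = 0
  end.

Lemma diff_degree q a b k :
  (diff F q a b)@_k != 0 -> (mdeg k + shift b)%N = shift a.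
Proof.
move=> nz; have nz' : diff F q a b != 0.
  by apply: contraNneq nz => ->; rewrite mcoeff0.
have [le /dhomogP hom] := diff_homog nz'.
have -> : mdeg k = (shift a - shift b)%N by apply: hom; rewrite mcoeff_msupp.
by rewrite subnK.
Qed.

Lemma aug_degree a b k : (aug F a b)@_k != 0 -> (mdeg k + 0)%N = shift a.
Proof.
rewrite ord1 => nz; rewrite addn0; have /dhomogP hom := aug_homog a.
by apply: hom; rewrite mcoeff_msupp.
Qed.

Lemma cycles_lift q v e : cycles v -> vhomog (@shift _ _ _ F q) e v ->
  exists2 u, vhomog (@shift _ _ _ F q.+1) e u & v = u *m diff F q.
Proof.
move=> cv hv.
have [u uE] : exists u, v = u *m diff F q.
  by case: q v cv {hv} => [|q] v /=; [move/exact_at_0|move/exact_at_S].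
rewrite uE in hv *.
have [u' hu' <-] := vhomog_lift (@diff_degree q) hv.
by exists u'.
Qed.

Lemma cycles_diff q (u : 'rV_(rk F q.+1)) : cycles (u *m diff F q).
Proof. by case: q u => [|q] u /=; [apply/exact_at_0|apply/exact_at_S]; exists u. Qed.

Variable d : nat.
Hypothesis shift_le : forall i (a : 'I_(rk F i)), (shift a <= d + i)%N.

(** The zigzag in the double complex of the Koszul complex and the resolution,
    by induction on the Koszul degree [p].  In degree 0 the bound on the shifts
    leaves no room for a constant term, so the chain is a Koszul boundary.
    Otherwise the boundary of [z] lifts to the next module of the resolution,
    where the induction hypothesis splits the lift; correcting [z] by the
    resulting chain gives a Koszul cycle. *)
Lemma resolution_koszul p : forall q e (z : {set 'I_n} -> 'rV[R]_(rk F q)),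
  (d + q < e)%N ->
  (forall S, #|S| != p -> z S = 0) ->
  (forall S, vhomog (@shift _ _ _ F q) e (z S)) ->
  (forall S, cycles (vdiff z S)) ->
  exists2 y, y set0 = 0
    & exists u, forall S, z S = vdiff y S + u S *m diff F q.
Proof.
elim: p => [|p IHp] q e z lt_e supp hom cyc.
  have [||y yE y0] := @vkoszul_exact _ z.
  - move=> S; apply/rowP=> a; rewrite !mxE /kdiff big1 // => s sS.
    by rewrite supp ?mxE ?mulr0 // cardsU1 sS.
  - move=> a; apply/eqP; apply: contraT => /hom; rewrite mdeg0 add0n => e'.
    by move: (shift_le a); rewrite e' leqNgt lt_e.
  exists y => //; exists (fun _ => 0) => S.
  by rewrite mul0mx addr0.
have /fin_all_exists [z' z'E] S : exists u : 'rV_(rk F q.+1),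
   [/\ (#|S| != p -> u = 0), vhomog (@shift _ _ _ F q.+1) e.+1 u
     & vdiff z S = u *m diff F q].
  have [Sp|Sp] := eqVneq #|S| p; last first.
    exists 0; split=> //; first by move=> a k; rewrite mxE mcoeff0 eqxx.
    rewrite mul0mx; apply/rowP=> a; rewrite !mxE /kdiff big1 // => s sS.
    by rewrite supp ?mxE ?mulr0 // cardsU1 sS.
  by have [u hu uE] := cycles_lift (cyc S) (vdiff_homog hom (S := S)); exists u.
have [||||y y0 [u uE]] := IHp q.+1 e.+1 z'.
- by rewrite addnS ltnS.
- by move=> S; case: (z'E S).
- by move=> S; case: (z'E S).
- move=> S /=; rewrite -vdiffM -(vdiff_vdiff z S).
  by apply: eq_vdiff => T; case: (z'E T).
have [||w wE w0] := @vkoszul_exact _ (fun S => z S - y S *m diff F q).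
- move=> S; rewrite vdiffB vdiffM; case: (z'E S) => _ _ ->.
  rewrite uE mulmxDl addrAC subrr add0r.
  exact: (cycles_diff (q := q.+1) (u S)).
- by move=> a; rewrite y0 mul0mx subr0 supp ?cards0 // mxE mcoeff0.
exists w => //; exists y => S.
by rewrite -wE subrK.
Qed.

End Resolution.
(** Koszul homology of an ideal with a [d]-linear resolution vanishes off the
    linear strand.  The number [e] is the degree of the polynomial coefficients,
    so the total degree of the cycle is [e + p]. *)
Lemma linear_koszul (J : R -> Prop) d : has_regularity J d ->
  forall p e f, (d < e)%N ->
  (forall S, #|S| != p -> f S = 0) ->
  (forall S k, (f S)@_k != 0 -> mdeg k = e) ->
  (forall S, J (f S)) -> kdiff f =1 (fun _ => 0) ->
  exists2 g, (forall S, J (g S)) & g set0 = 0 /\ f =1 kdiff g.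
Proof.
move=> [F [_ bettiF _]] p e f lt_de supp hom Jf df.
have shift_le i (a : 'I_(rk F i)) : (shift a <= d + i)%N.
  apply: bettiF; apply/eqP; rewrite -lt0n; apply/card_gt0P.
  by exists a; rewrite inE.
have /fin_all_exists [z zE] S : exists u : 'rV_(rk F 0),
   [/\ (#|S| != p -> u = 0), vhomog (@shift _ _ _ F 0) e u
     & f S = (u *m aug F) 0 0].
  have [Sp|Sp] := eqVneq #|S| p; last first.
    exists 0; split=> //; first by move=> a k; rewrite mxE mcoeff0 eqxx.
    by rewrite mul0mx mxE supp.
  have [u uE] := (aug_image F (f S)).1 (Jf S).
  have [|u' hu' u'E] := @vhomog_lift _ _ (aug F) (@shift _ _ _ F 0)
      (fun=> 0)%N (@aug_degree J F) u e.
    by move=> b k; rewrite ord1 -uE addn0; apply: hom.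
  by exists u'; split=> //; rewrite u'E.
have [||||y y0 [u uE]] :=
  resolution_koszul shift_le (p := p) (q := 0) (e := e) (z := z).
- by rewrite addn0.
- by move=> S; case: (zE S).
- by move=> S; case: (zE S).
- move=> S /=; rewrite -vdiffM; apply/rowP=> a; rewrite !mxE ord1 -(df S).
  by apply: eq_kdiff => T; case: (zE T).
exists (fun S => (y S *m aug F) 0 0).
  by move=> S; apply/(aug_image F); exists (y S).
split; first by rewrite y0 mul0mx mxE.
move=> S; case: (zE S) => _ _ ->; rewrite uE mulmxDl.
have -> : u S *m diff F 0 *m aug F = 0 by apply/exact_at_0; exists (u S).
by rewrite addr0 -vdiffM mxE.
Qed.

(** The same vanishing, for the Koszul homology of the quotient by J: a chain
    whose boundary has values in J is a boundary modulo J. *)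
Lemma linear_koszul_quotient (J : R -> Prop) d : has_regularity J d ->
  forall p e f, (d <= e)%N ->
  (forall S, #|S| != p.+1 -> f S = 0) ->
  (forall S k, (f S)@_k != 0 -> mdeg k = e) ->
  (forall S, J (kdiff f S)) ->
  exists g h, (forall S, J (g S)) /\ forall S, f S = g S + kdiff h S.
Proof.
move=> regJ p e f le_de supp hom Jdf.
have [|||||g Jg [g0 gE]] := linear_koszul regJ (p := p) (e := e.+1) (f := kdiff f).
- by [].
- move=> S Sp; rewrite /kdiff big1 // => s sS.
  by rewrite supp ?mulr0 // cardsU1 sS.
- move=> S k nz; rewrite -[LHS]addn0; move: S k nz.
  by apply: kdiff_homog => S k; rewrite addn0; apply: hom.
- exact: Jdf.
- exact: kdiff_kdiff.
have [||h hE _] := @koszul_exact (fun S => f S - g S).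
- by move=> S; rewrite kdiffB gE subrr.
- by rewrite g0 subr0 supp ?cards0 ?mcoeff0.
by exists g, h; split=> // S; rewrite -hE addrC subrK.
Qed.


(** * Two consequences for monomial ideals with a linear resolution *)

Section MonomialIdeal.
Variables (J : R -> Prop) (P : pred 'X_{1..n}) (d : nat).
Hypothesis JP : forall p : R, J p <-> (forall m, p@_m != 0 -> P m).
Hypothesis regJ : has_regularity J d.

(** The coefficient of e_S in multidegree [m] is a multiple of this
    monomial. *)
Definition face_mnm m S := (m - \sum_(s in S) U_(s))%MM.

Lemma face_mnmE m S j : face_mnm m S j = (m j - (j \in S))%N.
Proof.
rewrite mnmBE mnm_sumE; congr (_ - _)%N.
have [jS|jS] := boolP (j \in S).
  rewrite (bigD1 j) //= mnm1E eqxx big1 // => s /andP[_ ne].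
  by rewrite mnm1E (negbTE ne).
rewrite big1 // => s sS; rewrite mnm1E; case: eqP => // e.
by rewrite -e sS in jS.
Qed.

Section Cycle.
Variables (al : 'X_{1..n}) (T : {set 'I_n}).
Hypothesis alT : forall s, (0 < al s)%N = (s \in T).

(** The sign turns the Koszul boundary at a codimension two set into a plain
    difference of values at two vertices, see [mcoeff_kdiff_ridge]. *)
Definition facet_coef (h : chain) s :=
  ksign K s (T :\ s) * (h (T :\ s))@_(face_mnm al (T :\ s)).

Lemma mcoeff_kdiff_ridge (h : chain) a b : a \in T -> b \in T -> a != b ->
  (kdiff h (T :\ a :\ b))@_(face_mnm al (T :\ a :\ b)) =
  ksign K a (T :\ a :\ b) * ksign K b (T :\ b)
    * (facet_coef h b - facet_coef h a).
Proof.
move=> aT bT ab; set S := T :\ a :\ b.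
have aS : a \notin S by rewrite !inE eqxx andbF.
have bS : b \notin S by rewrite !inE eqxx.
have bSE : b |: S = T :\ a by rewrite /S setD1K // !inE eq_sym ab.
have aSE : a |: S = T :\ b.
  apply/setP=> x; rewrite !inE; have [->|xa] := eqVneq x a.
    by rewrite ab aT.
  by rewrite andbA.
have inS s : s \in T -> s != a -> s != b -> s \in S.
  by move=> sT sa sb; rewrite !inE sa sb sT.
move: (S) aS bS bSE aSE inS => {}S aS bS bSE aSE inS.
have faceU s : s \notin S -> (face_mnm al S - U_(s) = face_mnm al (s |: S))%MM.
  move=> sS; apply/mnmP=> j; rewrite mnmBE !face_mnmE mnm1E in_setU1.
  have [<-|ne] := eqVneq s j; last by rewrite subn0.
  by rewrite (negbTE sS) subn0.
have face_gt0 s : s \notin S -> (0 < face_mnm al S s)%N = (s \in T).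
  by move=> sS; rewrite face_mnmE (negbTE sS) subn0 alT.
have -> : (kdiff h S)@_(face_mnm al S) =
    ksign K a S * (h (T :\ b))@_(face_mnm al (T :\ b)) +
    ksign K b S * (h (T :\ a))@_(face_mnm al (T :\ a)).
  rewrite mcoeff_kdiff (bigD1 a) /=; last by rewrite aS face_gt0.
  rewrite (bigD1 b) /=; last by rewrite bS face_gt0 // bT eq_sym.
  rewrite big1 => [|s /andP[/andP[/andP[sS]]]].
    by rewrite addr0 !faceU // aSE bSE.
  by rewrite face_gt0 // => sT sa sb; rewrite inS in sS.
have sw := @ksign_swap K a b S aS bS ab; rewrite aSE bSE in sw.
rewrite mulrBr /facet_coef; congr (_ + _).
  by rewrite -mulrA (mulrA (ksign K b _)) ksignK mul1r.
by rewrite sw mulNr opprK -mulrA (mulrA (ksign K a _)) ksignK mul1r.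
Qed.

(** The pairs [c j], [c j.+1] are outside J, whereas adding any third vertex to
    [c 0], [c 1] gives a monomial of J.  Hence the chain carried by the
    complement of [c 0], [c 1] is a cycle modulo J.  Were it a boundary modulo J, the
    values [facet_coef] would be constant along [c 1], ..., [c k] = [c 0] and
    yet differ by 1 between [c 0] and [c 1]. *)
Lemma koszul_cycle (c : nat -> 'I_n) k : (2 < k)%N -> c k = c 0%N ->
  (forall i j, (i < k)%N -> (j < k)%N -> c i = c j -> i = j) ->
  (forall j, (j < k)%N -> c j \in T) ->
  (d <= mdeg (face_mnm al (T :\ c 0%N :\ c 1%N)))%N ->
  (forall j, (j < k)%N -> ~~ P (face_mnm al (T :\ c j :\ c j.+1))) ->
  (forall s, s \in T :\ c 0%N :\ c 1%N ->
     P (face_mnm al (T :\ c 0%N :\ c 1%N :\ s))) -> False.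
Proof.
move=> k_gt2 ck inj cT dle negP posP.
have c01 : c 0%N != c 1%N by apply/eqP => /inj; lia.
have cS j : (j < k)%N -> c j.+1 \in T.
  by rewrite leq_eqVlt => /predU1P[->|]; [rewrite ck; apply: cT; lia|apply: cT].
have cneq j : (j < k)%N -> c j != c j.+1.
  move=> lt; apply/eqP; have [lt'|ge] := ltnP j.+1 k.
    by move/inj => /(_ lt lt'); lia.
  have -> : j.+1 = k by lia.
  by rewrite ck => /inj; lia.
set S0 := T :\ c 0%N :\ c 1%N in dle posP.
pose f S : R := if S == S0 then 'X_[face_mnm al S0] else 0.
have [||||g [h [Jg fE]]] :=
    @linear_koszul_quotient J d regJ #|S0|.-1 (mdeg (face_mnm al S0)) f.
- exact: dle.
- move=> S; rewrite /f; case: (S =P S0) => // ->.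
  rewrite prednK ?eqxx // card_gt0; apply/set0Pn; exists (c 2%N).
  rewrite !inE cT //; apply/andP; split; first by apply/eqP => /inj; lia.
  by rewrite andbT; apply/eqP => /inj; lia.
- move=> S m; rewrite /f; case: (S =P S0) => _; last by rewrite mcoeff0 eqxx.
  by rewrite mcoeffX; case: (_ =P m) => [->|] //; rewrite eqxx.
- move=> S; apply/JP => m /mcoeff_kdiff_neq0[s [sS ms]].
  rewrite /f; case: (_ =P S0) => [SE|]; last by rewrite mcoeff0 eqxx.
  rewrite mcoeffX; case: (_ =P (m - _)%MM) => [mE _|]; last by rewrite eqxx.
  have sS0 : s \in S0 by rewrite -SE setU11.
  suff -> : m = face_mnm al (S0 :\ s) by apply: posP.
  have -> : m = (face_mnm al S0 + U_(s))%MM by rewrite mE submK ?mnm1_le.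
  apply/mnmP=> j; rewrite mnmDE !face_mnmE mnm1E [j \in S0 :\ s]in_setD1.
  have [<-|ne] := eqVneq s j; last by rewrite addn0.
  rewrite sS0 subn0 subnK // alT.
  by move: sS0; rewrite !inE => /and3P[].
have step j : (j < k)%N ->
  (f (T :\ c j :\ c j.+1))@_(face_mnm al (T :\ c j :\ c j.+1)) =
   ksign K (c j) (T :\ c j :\ c j.+1) * ksign K (c j.+1) (T :\ c j.+1)
    * (facet_coef h (c j.+1) - facet_coef h (c j)).
  move=> lt; rewrite fE mcoeffD (mcoeff_kdiff_ridge h (cT j lt) (cS j lt) (cneq j lt)).
  have /eqP -> : (g (T :\ c j :\ c j.+1))@_(face_mnm al (T :\ c j :\ c j.+1)) == 0.
    by apply: contraR (negP j lt); apply: (JP _).1.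
  by rewrite add0r.
have const j : (0 < j < k)%N -> facet_coef h (c j.+1) = facet_coef h (c j).
  case/andP=> j_gt0 lt; move: (step j lt); rewrite /f ifN; last first.
    apply/eqP => /setP e; have [j1|j1] := eqVneq j 1%N.
      move: (e (c 2%N)); rewrite !inE j1 eqxx /= cT //= !andbT.
      case/esym/andP; split; first by apply/eqP => /inj; lia.
      by apply/eqP => /inj; lia.
    move: (e (c j)); rewrite !inE eqxx andbF cT //= !andbT.
    case/esym/andP; split; first by apply/eqP => /inj; lia.
    by apply/eqP => /inj; lia.
  rewrite mcoeff0 => /esym/eqP; rewrite !mulf_eq0 subr_eq0 !signr_eq0 /=.
  by move/eqP.
have const1 j : (0 < j <= k)%N -> facet_coef h (c j) = facet_coef h (c 1%N).
  elim: j => // -[|j] IHj // lt; rewrite const; last by lia.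
  by apply: IHj; lia.
move: (step 0%N (ltn_trans (isT : (0 < 2)%N) k_gt2)); rewrite /f eqxx mcoeffX eqxx.
rewrite -(const1 k) ?ck ?subrr ?mulr0; last by lia.
by move/eqP; rewrite oner_eq0.
Qed.

End Cycle.
(** Going down as long as possible gives a common multiple [m] such that no
    [m - U_(s)] is a common multiple.  The variables [s] with [m - U_(s)] in the
    first family form a set B which no edge of the upper Koszul complex at [m]
    leaves, and a variable inside and one outside of B give a Koszul 1-cycle.
    Restricting a primitive to B and applying the boundary twice shows that the
    coefficients over B of a boundary sum to 0, while those of this cycle sum
    to 1. *)
Lemma linear_syzygies (Q Q' : pred 'X_{1..n}) (m0 : 'X_{1..n}) :
  (forall m, (m <= m0)%MM -> P m -> Q m || Q' m) ->
  (forall m, Q m -> P m) -> (forall m, Q' m -> P m) ->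
  (forall m m', (m <= m')%MM -> Q m -> Q m') ->
  (forall m m', (m <= m')%MM -> Q' m -> Q' m') ->
  (forall m, Q m -> (d < mdeg m)%N -> exists2 s, (0 < m s)%N & Q (m - U_(s))%MM) ->
  (forall m, Q' m -> (d < mdeg m)%N -> exists2 s, (0 < m s)%N & Q' (m - U_(s))%MM) ->
  (forall m, (m <= m0)%MM -> Q m -> Q' m -> (d.+1 < mdeg m)%N) ->
  forall m, (m <= m0)%MM -> Q m -> Q' m -> False.
Proof.
move=> PQ QP Q'P upQ upQ' downQ downQ' degQQ' m.
elim: {m}(mdeg m) {-2}m (erefl (mdeg m)) => [|N IHN] m mN le_m Qm Q'm.
  by have := degQQ' m le_m Qm Q'm; rewrite mN.
have le_sub s m' : (m' - U_(s) <= m')%MM by exact: lem_subr.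
have both s : (0 < m s)%N -> Q (m - U_(s))%MM -> Q' (m - U_(s))%MM -> False.
  move=> ms; apply: IHN; last exact: lepm_trans (le_sub s m) le_m.
  have le_s : (U_(s) <= m)%MM by rewrite mnm1_le.
  by move: mN; rewrite -{1}(submK le_s) mdegD mdeg1 addn1 => -[].
have ltd := degQQ' m le_m Qm Q'm.
have [s ms Qs] := downQ m Qm (ltnW ltd).
have [s' ms' Qs'] := downQ' m Q'm (ltnW ltd).
have ss' : s != s' by apply/eqP=> e; apply: (both s) => //; rewrite e.
pose B := [set r : 'I_n | (0 < m r)%N && Q (m - U_(r))%MM].
pose z S : R := if S == [set s] then 'X_[m - U_(s)]
           else if S == [set s'] then - 'X_[m - U_(s')] else 0.
have z1 r : z [set r] = if r == s then 'X_[m - U_(s)]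
    else if r == s' then - 'X_[m - U_(s')] else 0.
  by rewrite /z !(inj_eq set1_inj).
have z0 S : #|S| != 1%N -> z S = 0.
  by move=> S1; rewrite /z; do 2![case: eqP => [e|_]; first by rewrite e cards1 in S1].
have degU r : (0 < m r)%N -> mdeg (m - U_(r)) = N.
  move=> mr; have le_r : (U_(r) <= m)%MM by rewrite mnm1_le.
  by move: mN; rewrite -{1}(submK le_r) mdegD mdeg1 addn1 => -[].
have XU r : (0 < m r)%N -> 'X_r * 'X_[m - U_(r)] = 'X_[m] :> R.
  by move=> mr; rewrite -mpolyXD addmC submK ?mnm1_le.
have [|||||y Jy [_ zE]] := linear_koszul regJ (p := 1) (e := N) (f := z).
- by rewrite mN ltnS in ltd.
- exact: z0.
- move=> S k; rewrite /z; case: ifP => _; last case: ifP => _.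
  + by rewrite mcoeffX; case: (_ =P k) => [<-|]; rewrite ?eqxx ?degU.
  + by rewrite mcoeffN mcoeffX; case: (_ =P k) => [<-|]; rewrite ?oppr0 ?eqxx ?degU.
  + by rewrite mcoeff0 eqxx.
- move=> S; apply/JP => k; rewrite /z; case: ifP => _; last case: ifP => _.
  + by rewrite mcoeffX; case: (_ =P k) => [<- _|]; rewrite ?eqxx //; apply: QP.
  + by rewrite mcoeffN mcoeffX; case: (_ =P k) => [<- _|]; rewrite ?oppr0 ?eqxx //; apply: Q'P.
  + by rewrite mcoeff0 eqxx.
- move=> S; have [->|/set0Pn[q qS]] := eqVneq S set0; last first.
    rewrite /kdiff big1 // => r rS; rewrite z0 ?mulr0 // cardsU1 rS.
    by rewrite (cardsD1 q) qS.
  have ks0 r : ksign R r set0 = 1.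
    rewrite /ksign (_ : [set j in set0 | _] = set0) ?cards0 //.
    by apply/setP => j; rewrite !inE.
  rewrite /kdiff (bigD1 s) ?inE //= (bigD1 s') /=; last by rewrite inE eq_sym.
  rewrite big1 ?addr0 => [|r /andP[/andP[_ rs] rs']].
    rewrite !setU0 !z1 !ks0 eqxx [s' == s]eq_sym (negbTE ss') eqxx.
    by rewrite mulrN !mul1r !XU // subrr.
  by rewrite setU0 z1 (negbTE rs) (negbTE rs') !mulr0.
(* y' restricts the primitive y to the variables of B. *)
pose y' S : R := if S \subset B then y S else 0.
have Py S k : (y S)@_k != 0 -> P k by apply: (JP _).1.
have dy' r : (0 < m r)%N ->
  (kdiff y' [set r])@_(m - U_(r))%MM = if r == s then 1 else 0.
  move=> mr; have [rB|rB] := boolP (r \in B); last first.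
    rewrite /kdiff big1 ?mcoeff0 => [|q _].
      case: eqP => // e; rewrite inE in rB.
      by rewrite e ms Qs in rB.
    by rewrite /y' ifN ?mulr0 // subUset !sub1set negb_and rB orbT.
  have -> : (if r == s then 1 else 0) = (z [set r])@_(m - U_(r))%MM.
    rewrite z1; case: eqP => [->|_]; first by rewrite mcoeffX eqxx.
    case: eqP => [e|_]; last by rewrite mcoeff0.
    by move: rB; rewrite inE e => /andP[_ /both[]].
  rewrite zE !mcoeff_kdiff; apply: eq_bigr => q /andP[qr mq].
  rewrite /y'; case: ifP => // qB; rewrite mcoeff0 mulr0.
  have [->|/Py] := eqVneq (y (q |: [set r]))@_(m - U_(r) - U_(q))%MM 0.
    by rewrite mulr0.
  have swap : (m - U_(r) - U_(q) = m - U_(q) - U_(r))%MM.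
    by rewrite !submDA addmC.
  have mq' : (0 < m q)%N by apply: leq_trans mq _; rewrite mnmBE leq_subr.
  move/PQ => /(_ (lepm_trans (le_sub _ _) (lepm_trans (le_sub _ _) le_m))).
  case/orP => [Qrq|Q'rq].
    case/negP: (negbT qB); rewrite subUset !sub1set rB andbT inE mq'.
    by rewrite swap in Qrq; rewrite (upQ _ _ (le_sub _ _) Qrq).
  case: (both r mr); first by move: rB; rewrite inE => /andP[].
  exact: upQ' (le_sub _ _) Q'rq.
have := kdiff_kdiff y' set0 => /(congr1 (mcoeff m)).
rewrite mcoeff0 mcoeff_kdiff (bigD1 s) /=; last by rewrite inE ms.
rewrite setU0 dy' // eqxx big1 ?addr0 => [|r /andP[/andP[_ mr] /negbTE rs]].
  by move/eqP; rewrite mulr1 signr_eq0.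
by rewrite setU0 dy' // rs mulr0.
Qed.

End MonomialIdeal.
End Koszul.

(** * Components of the edge ideal *)

Section EdgeIdeal.
Variables (n : nat) (K : fieldType) (D : wograph n).
Local Notation R := {mpoly K[n]}.

Lemma ideal_gen0 (A : comNzRingType) (S : A -> Prop) : ideal_gen S 0.
Proof. by exists [::]; rewrite big_nil. Qed.

Lemma ideal_genD (A : comNzRingType) (S : A -> Prop) p q :
  ideal_gen S p -> ideal_gen S q -> ideal_gen S (p + q).
Proof.
move=> [s [Ss ->]] [t [St ->]]; exists (s ++ t); rewrite big_cat; split=> // x.
by rewrite mem_cat => /orP[/Ss|/St].
Qed.

Lemma ideal_genM (A : comNzRingType) (S : A -> Prop) p q :
  S q -> ideal_gen S (p * q).
Proof.
by move=> Sq; exists [:: (p, q)]; rewrite big_seq1; split=> // x; rewrite inE => /eqP ->.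
Qed.

Definition arc_mnm i j : 'X_{1..n} := (U_(i) + U_(j) *+ weight D j)%MM.

Lemma arc_mnm_le i j m : arc D i j ->
  (arc_mnm i j <= m)%MM = (0 < m i)%N && (weight D j <= m j)%N.
Proof.
move=> ij; have ne : i != j by apply: contraTneq ij => ->; rewrite arc_irr.
have E s : arc_mnm i j s = ((i == s) + (j == s) * weight D j)%N.
  by rewrite mnmDE mulmnE !mnm1E.
apply/mnm_lepP/andP => [h|[hi hj] s].
  move: (h i) (h j); rewrite !E !eqxx eq_sym (negbTE ne) mul0n mul1n addn0 add0n.
  by move=> -> ->.
rewrite E; have [<-|_] := eqVneq i s.
  by rewrite eq_sym (negbTE ne).
by have [<-|_] := eqVneq j s; rewrite ?mul1n.
Qed.

Lemma mdeg_arc_mnm i j : mdeg (arc_mnm i j) = (weight D j).+1.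
Proof. by rewrite mdegD mdegMn !mdeg1 mul1n. Qed.

(** Monomials of degree at least [d] divisible by a generator of degree at most
    [d] whose head satisfies [E].  For [E] always true these are the monomials of
    the degree [d] component ideal, see [degree_component_mnm]. *)
Definition comp_mnm (E : pred 'I_n) d : pred 'X_{1..n} := fun m =>
  (d <= mdeg m)%N && [exists i, exists j,
    [&& arc D i j, E j, (weight D j < d)%N & (arc_mnm i j <= m)%MM]].

Lemma comp_mnmP (E : pred 'I_n) d m :
  reflect ((d <= mdeg m)%N /\ exists i j,
            [/\ arc D i j, E j, (weight D j < d)%N & (arc_mnm i j <= m)%MM])
          (comp_mnm E d m).
Proof.
apply: (iffP andP) => -[dm].
  by case/existsP=> i /existsP[j /and4P[ij Ej lt le]]; split=> //; exists i, j.
case=> i [j [ij Ej lt le]]; split=> //; apply/existsP; exists i; apply/existsP; exists j.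
by rewrite ij Ej lt le.
Qed.

Lemma mdeg_le (m m' : 'X_{1..n}) : (m <= m')%MM -> (mdeg m <= mdeg m')%N.
Proof. by move=> le; rewrite -(submK le) mdegD leq_addl. Qed.

Lemma comp_mnm_up E d m m' : (m <= m')%MM -> comp_mnm E d m -> comp_mnm E d m'.
Proof.
move=> le /comp_mnmP[dm [i [j [ij Ej lt le']]]]; apply/comp_mnmP; split.
  exact: leq_trans dm (mdeg_le le).
by exists i, j; split=> //; apply: lepm_trans le' le.
Qed.

Lemma comp_mnm_down E d m : comp_mnm E d m -> (d < mdeg m)%N ->
  exists2 s, (0 < m s)%N & comp_mnm E d (m - U_(s))%MM.
Proof.
case/comp_mnmP=> _ [i [j [ij Ej lt le]]] dm.
have [s ms] : exists s, (arc_mnm i j s < m s)%N.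
  apply/existsP; apply: contraLR dm => /existsPn h; rewrite -leqNgt.
  apply: leq_trans (_ : mdeg (arc_mnm i j) <= _)%N; last by rewrite mdeg_arc_mnm.
  by rewrite !mdegE; apply: leq_sum => s _; rewrite leqNgt.
have ms0 : (0 < m s)%N by apply: leq_trans ms.
exists s => //; apply/comp_mnmP; split.
  have le_s : (U_(s) <= m)%MM by rewrite mnm1_le.
  by move: dm; rewrite -{1}(submK le_s) mdegD mdeg1 addn1 ltnS.
exists i, j; split=> //; apply/mnm_lepP => r; rewrite mnmBE mnm1E.
have [<-|_] := eqVneq s r; last by rewrite subn0; move/mnm_lepP: le.
by rewrite -ltnS -subSn // subn1.
Qed.

Lemma mcoeff_neq0M (p q : R) m : (p * q)@_m != 0 ->
  exists m1 m2, [/\ m = (m1 + m2)%MM, p@_m1 != 0 & q@_m2 != 0].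
Proof.
rewrite -mcoeff_msupp => /msuppM_le/allpairsP[[m1 m2] /= [m1p m2q ->]].
by exists m1, m2; rewrite -!mcoeff_msupp.
Qed.

Lemma mcoeff_ideal_gen (S : R -> Prop) (p : R) m : ideal_gen S p -> p@_m != 0 ->
  exists q m', [/\ S q, (m' <= m)%MM & q@_m' != 0].
Proof.
move=> [s [Ss ->]]; rewrite raddf_sum => nz.
have [x xs nzx] : exists2 x, x \in s & (x.1 * x.2)@_m != 0.
  apply/hasP; apply: contraR nz => /hasPn h; rewrite big1_seq //= => x xs.
  by apply/eqP; move: (h x xs); rewrite negbK.
have [m1 [m2 [-> _ nz2]]] := mcoeff_neq0M nzx.
by exists x.2, m2; split=> //; [apply: Ss | apply: lem_addl].
Qed.

Lemma edge_ideal_mnm (p : R) m : edge_ideal D p -> p@_m != 0 ->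
  exists i j, arc D i j /\ (arc_mnm i j <= m)%MM.
Proof.
move=> Ip nz; have [q [m' [[i [j [ij ->]]] le]]] := mcoeff_ideal_gen Ip nz.
rewrite mpolyXn -mpolyXD mcoeffX; case: (_ =P m') => [e _|]; last by rewrite eqxx.
by exists i, j; rewrite /arc_mnm e.
Qed.

Lemma mnm_between d (m m' : 'X_{1..n}) : (m <= m')%MM -> (mdeg m <= d)%N -> (d <= mdeg m')%N ->
  exists m1, [/\ (m <= m1)%MM, (m1 <= m')%MM & mdeg m1 = d].
Proof.
move=> le; elim: d => [|d IHd].
  by rewrite leqn0 => d0 _; exists m; rewrite lepm_refl (eqP d0).
rewrite leq_eqVlt => /predU1P[e _|lt dm']; first by exists m; rewrite lepm_refl.
have [m1 [le1 le1' d1]] := IHd lt (ltnW dm').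
have [s ms] : exists s, (m1 s < m' s)%N.
  apply/existsP; apply: contraLR dm' => /existsPn h; rewrite -ltnNge ltnS -d1 !mdegE.
  by apply: leq_sum => s _; rewrite leqNgt.
exists (m1 + U_(s))%MM; split; last by rewrite mdegD mdeg1 d1 addn1.
  by apply: lepm_trans le1 _; exact: lem_addr.
apply/mnm_lepP => j; rewrite mnmDE mnm1E.
by have [<-|_] := eqVneq s j; rewrite ?addn1 // addn0; move/mnm_lepP: le1'.
Qed.

Lemma degree_component_mnm d (p : R) :
  degree_component_ideal (edge_ideal D) d p <->
  (forall m, p@_m != 0 -> comp_mnm predT d m).
Proof.
split=> [Jp m nz|h].
  have [q [m' [[Iq /dhomogP hom] le nzq]]] := mcoeff_ideal_gen Jp nz.
  have dm' : mdeg m' = d by apply: hom; rewrite mcoeff_msupp.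
  have [i [j [ij le']]] := edge_ideal_mnm Iq nzq.
  apply/andP; split.
    by rewrite -dm' -(submK le) mdegD leq_addl.
  apply/existsP; exists i; apply/existsP; exists j; rewrite ij (lepm_trans le' le) andbT /=.
  by rewrite -dm' -(submK le') mdegD mdeg_arc_mnm leq_addl.
rewrite (mpolyE p); have: forall m, m \in msupp p -> p@_m != 0.
  by move=> m; rewrite mcoeff_msupp.
elim: (msupp p) => [|m s IHs] sub.
  by rewrite big_nil; apply: ideal_gen0.
rewrite big_cons; apply: ideal_genD; last first.
  by apply: IHs => m' m's; apply: sub; rewrite inE m's orbT.
have /h /andP[dm /existsP[i /existsP[j /and4P[ij _ lt le]]]] : p@_m != 0.
  by apply: sub; rewrite mem_head.
have [|m1 [le1 le1' d1]] := @mnm_between d _ _ le _ dm; first by rewrite mdeg_arc_mnm.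
rewrite -(submK le1') mpolyXD -mul_mpolyC mulrA; apply: ideal_genM; split.
  rewrite -(submK le1) mpolyXD; apply: ideal_genM; exists i, j; split=> //.
  by rewrite mpolyXD mpolyXn.
by rewrite dhomogX; apply/eqP.
Qed.

End EdgeIdeal.

(** * Light edges, heavy pairs and linearity *)

Section ComponentwiseLinear.
Variables (n : nat) (K : fieldType) (D : wograph n).
Local Notation R := {mpoly K[n]}.
Hypothesis cwl : componentwise_linear (@edge_ideal K n D).

Lemma component_regularity d m : comp_mnm D predT d m ->
  has_regularity (degree_component_ideal (@edge_ideal K n D) d) d.
Proof.
move=> Pm; case: (cwl d) => // /(_ 'X_[m]) J0; have : 'X_[m] = 0 :> R.
  apply: J0; apply/degree_component_mnm => k.
  by rewrite mcoeffX; case: (_ =P k) => [<-|]; rewrite ?eqxx.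
by move/(congr1 (mcoeff m))/eqP; rewrite mcoeffX mcoeff0 eqxx oner_eq0.
Qed.

Definition light x y := arc D x y && (weight D y == 1%N) || arc D y x && (weight D x == 1%N).

Definition heavy x y := (x != y) && ~~ light x y.

Lemma light_sym : ssrbool.symmetric light.
Proof. by move=> x y; rewrite /light orbC. Qed.

Lemma heavy_sym : ssrbool.symmetric heavy.
Proof. by move=> x y; rewrite /heavy eq_sym light_sym. Qed.

Lemma light_irr x : light x x = false.
Proof. by rewrite /light arc_irr. Qed.

(** [koszul_cycle] on the closed walk v, a, s, in the multidegree where v has
    exponent [t] and the other vertices exponent 1.  Consecutive vertices give
    monomials outside the component of degree [t + 1]; when [t > 1] this uses
    that the neighbours of v on the walk have no arc into v and that light arcs
    do not leave v.  The last hypothesis puts every triangle on the pair v, a in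
    the component. *)
Lemma heavy_cycle t v a (s : seq 'I_n) :
  path heavy a s -> uniq [:: v, a & s] -> s != [::] ->
  heavy v a -> heavy v (last a s) ->
  t = 1%N \/ [/\ (1 < t)%N, t = weight D v, ~~ arc D a v, ~~ arc D (last a s) v
              & forall x, x \in a :: s -> arc D v x -> weight D x != 1%N] ->
  (forall x, x \in s -> [\/ light a x, light v x | arc D x v /\ t = weight D v]) ->
  False.
Proof.
move=> pathH uniqs s0 Hva Hvb tP triP.
have t_gt0 : (0 < t)%N by case: tP => [->|[/ltnW]].
set p := [:: v, a & s] in uniqs.
pose T := [set x in p]; pose c j := nth v p j; pose k := size p.
pose al : 'X_{1..n} := (\sum_(x in T) U_(x) + U_(v) *+ t.-1)%MM.
have alE x : al x = ((x \in T) + (v == x) * t.-1)%N.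
  rewrite /al mnmDE mulmnE mnm1E mnm_sumE; congr (_ + _)%N.
  have [xT|xT] := boolP (x \in T).
    rewrite (bigD1 x) //= mnm1E eqxx big1 // => y /andP[_ ne].
    by rewrite mnm1E (negbTE ne).
  rewrite big1 // => y yT; rewrite mnm1E; case: eqP => // e.
  by rewrite -e yT in xT.
have vT : v \in T by rewrite !inE eqxx.
have alT x : (0 < al x)%N = (x \in T).
  rewrite alE; case: (boolP (x \in T)) => [//|xT].
  by case: eqP => [e|//]; rewrite -e vT in xT.
have cT j : (j < k)%N -> c j \in T by move=> lt; rewrite inE mem_nth.
have ck : c k = c 0%N by rewrite /c nth_default.
have inj i j : (i < k)%N -> (j < k)%N -> c i = c j -> i = j.
  by move=> li lj /eqP; rewrite nth_uniq // => /eqP.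
have k_gt2 : (2 < k)%N by rewrite /k /=; case: (s) s0.
have va : v != a by case/andP: Hva.
have faceE (U : {set 'I_n}) S z : U \subset T -> S = T :\: U ->
    face_mnm al S z = ((z \in U) + (v == z) * t.-1)%N.
  move=> /subsetP UT ->; rewrite face_mnmE alE in_setD.
  have [/UT ->|zU] := boolP (z \in U); first by rewrite subn0.
  by case: (z \in T); rewrite /= ?addKn ?subn0 add0n.
have setT2 x y : T :\ x :\ y = T :\: [set x; y].
  by apply/setP=> z; rewrite !inE negb_or andbA [_ && (z != x)]andbC.
have heavyc j : (j < k)%N -> heavy (c j) (c j.+1).
  have : cycle heavy p.
    by rewrite /= rcons_path Hva pathH [heavy (last a s) v]heavy_sym.
  rewrite /cycle /p => /(pathP v) /(_ j); rewrite size_rcons => h lt.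
  have := h lt; rewrite -rcons_cons !nth_rcons [(j < size (v :: _))%N]lt.
  rewrite /c /=; case: ltnP => // le; rewrite if_same.
  by rewrite (@nth_default _ v (a :: s)).
have cS j : (j < k)%N -> c j.+1 \in T.
  by rewrite leq_eqVlt => /predU1P[->|/cT //]; rewrite ck cT.
have clast : c k.-1 = last a s by rewrite /c nth_last.
have light_mnm x y (m : 'X_{1..n}) : light x y -> (0 < m x)%N -> (0 < m y)%N ->
    (t < mdeg m)%N -> comp_mnm D predT t.+1 m.
  move=> lxy mx my dm; apply/comp_mnmP; split=> //.
  by case/orP: lxy => /andP[xy /eqP w1]; [exists x, y | exists y, x];
    rewrite arc_mnm_le // w1 mx my; split.
have posP x : x \in T :\ v :\ a -> comp_mnm D predT t.+1 (face_mnm al (T :\ v :\ a :\ x)).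
  move=> xS; have xs : x \in s by move: xS; rewrite !inE => /and3P[/negbTE-> /negbTE->].
  have [xv xa] : x != v /\ x != a by move: xS; rewrite !inE => /and3P[].
  have F z : face_mnm al (T :\ v :\ a :\ x) z
             = ((z \in [set v; a; x]) + (v == z) * t.-1)%N.
    apply: faceE; last first.
      by apply/setP=> y; rewrite !inE !negb_or -!andbA; do !bool_congr.
    apply/subsetP=> y; rewrite !inE -orbA => /or3P[]/eqP->; rewrite ?eqxx ?orbT //.
    by rewrite xs !orbT.
  have Fv : face_mnm al (T :\ v :\ a :\ x) v = t.
    by rewrite F !inE eqxx mul1n add1n prednK.
  have [Fa Fx] : (0 < face_mnm al (T :\ v :\ a :\ x) a)%N /\
                 (0 < face_mnm al (T :\ v :\ a :\ x) x)%N.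
    by rewrite !F !inE !eqxx !orbT.
  have dF : (t < mdeg (face_mnm al (T :\ v :\ a :\ x)))%N.
    apply: leq_trans (_ : mdeg (U_(v) *+ t + U_(a))%MM <= _)%N.
      by rewrite mdegD mdegMn !mdeg1 mul1n addn1.
    apply: mdeg_le; apply/mnm_lepP=> z; rewrite mnmDE mulmnE !mnm1E.
    have [<-|_] := eqVneq v z; first by rewrite [a == v]eq_sym (negbTE va) Fv mul1n addn0.
    by have [<-|_] := eqVneq a z.
  case: (triP x xs) => [la|lv|[xv' tE]].
  - exact: (light_mnm a x).
  - by apply: (light_mnm v x) => //; rewrite Fv.
  - apply/comp_mnmP; split=> //; exists x, v; split=> //; first by rewrite -tE.
    by rewrite arc_mnm_le // Fx Fv -tE leqnn.
have negP j : (j < k)%N -> ~~ comp_mnm D predT t.+1 (face_mnm al (T :\ c j :\ c j.+1)).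
  move=> lt; apply/negP=> /comp_mnmP[_ [x [y [xy _ wy]]]].
  have F z := @faceE [set c j; c j.+1] _ z _ (setT2 _ _).
  have UT : [set c j; c j.+1] \subset T.
    apply/subsetP=> z; rewrite !inE => /orP[]/eqP->;
      [have := cT j lt|have := cS j lt]; by rewrite inE.
  rewrite arc_mnm_le // !F // => /andP[Fx Fy].
  have xy' : x != y by apply: contraTneq xy => ->; rewrite arc_irr.
  have notlight x' y' : x' \in [set c j; c j.+1] -> y' \in [set c j; c j.+1] ->
      x' != y' -> ~~ light x' y'.
    have /andP[_ nl] := heavyc j lt.
    rewrite !inE => /orP[]/eqP-> /orP[]/eqP->; rewrite ?eqxx // => _.
    by rewrite light_sym.
  have wpos := weight_gt0 D y.
  have [yv|yv] := eqVneq y v; last first.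
    have [yU w1] : y \in [set c j; c j.+1] /\ weight D y = 1%N.
      move: Fy; rewrite [v == y]eq_sym (negbTE yv) mul0n addn0.
      case: (boolP (y \in [set c j; c j.+1])) => [yU le|_ le].
        by split=> //; apply/eqP; rewrite eqn_leq le wpos.
      by move: (leq_trans wpos le).
    have [xU|xU] := boolP (x \in [set c j; c j.+1]).
      by move: (notlight x y xU yU xy'); rewrite /light xy w1.
    move: Fx; rewrite (negbTE xU); case: eqP => [xv|//].
    case: tP => [->//|[t1 _ _ _ h]] _.
    have : y \in a :: s.
      by have := subsetP UT _ yU; rewrite !inE (negbTE yv).
    by move/h; rewrite xv w1 => /(_ xy).
  have xU : x \in [set c j; c j.+1].
    move: Fx; rewrite [v == x]eq_sym -yv (negbTE xy') mul0n addn0.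
    by case: (x \in [set c j; c j.+1]).
  rewrite {y}yv in xy wy Fy xy' wpos.
  have vU : v \in [set c j; c j.+1].
    move: Fy; rewrite eqxx mul1n.
    case: (v \in [set c j; c j.+1]) => //; rewrite add0n => le.
    case: tP => [t1|[_ tw _ _ _]]; last by move: le; rewrite -tw -ltnS prednK // ltnn.
    by move: (leq_trans wpos le); rewrite t1.
  case: tP => [t1|[t1 tw nav nbv _]].
    have w1 : weight D v = 1%N.
      by apply/eqP; rewrite eqn_leq wpos andbT; move: Fy; rewrite vU t1 muln0.
    by move: (notlight x v xU vU xy'); rewrite /light xy w1.
  have [j0 j1] : (c j = v -> j = 0%N) /\ (c j.+1 = v -> j = k.-1).
    have k_gt0 : (0 < k)%N := leq_ltn_trans (leq0n j) lt.
    split=> e; first exact: inj lt k_gt0 e.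
    have [lt1|ge] := ltnP j.+1 k; first by have := inj _ _ lt1 k_gt0 e.
    have kE : k = j.+1 by apply/eqP; rewrite eqn_leq ge lt.
    by rewrite kE.
  have {xU} : x = a \/ x = last a s.
    move: xU vU xy'; rewrite !inE => /orP[]/eqP-> /orP[]/eqP ve; rewrite ?ve ?eqxx // => _.
      by right; rewrite (j1 (esym ve)) clast.
    by left; rewrite (j0 (esym ve)).
  by case=> e; move: xy; rewrite e; apply/negP.
have [x xs] : exists x, x \in s.
  by case: (s) s0 => // x s' _; exists x; rewrite mem_head.
have xS : x \in T :\ v :\ a.
  have /and3P[vs as_ _] := uniqs; rewrite !inE xs !orbT andbT.
  apply/andP; split; first by apply: contraNneq as_ => <-.
  by apply: contraNneq vs => <-; rewrite inE xs orbT.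
have reg := component_regularity (posP x xS).
have := @koszul_cycle n K _ _ _ (@degree_component_mnm n K D t.+1) reg al T alT c k k_gt2 ck inj cT.
apply=> //=.
have F z := @faceE [set v; a] _ z _ (setT2 _ _).
apply: leq_trans (_ : mdeg (U_(v) *+ t + U_(a))%MM <= _)%N.
  by rewrite mdegD mdegMn !mdeg1 mul1n addn1.
apply: mdeg_le; apply/mnm_lepP=> z; rewrite mnmDE mulmnE !mnm1E F.
  rewrite !inE; have [<-|_] := eqVneq v z.
    by rewrite [a == v]eq_sym (negbTE va) !mul1n addn0 add1n prednK.
  by case: (eqVneq a z) => _; rewrite ?orbT.
by apply/subsetP=> y; rewrite !inE => /orP[]/eqP->; rewrite eqxx ?orbT.
Qed.

(** Without light edges among these four vertices, the generators with head v
    and the other ones are two families as in [linear_syzygies]: heads other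
    than v have weight at least 2 there, so a common multiple of two generators
    has degree at least [weight v + 3]. *)
Lemma light_arc v i a b :
  arc D i v -> (1 < weight D v)%N ->
  arc D a b -> b != v -> (weight D b <= weight D v)%N ->
  exists x y, [/\ x \in [:: v; i; a; b], y \in [:: v; i; a; b] & light x y].
Proof.
move=> iv t_gt1 ab bv wb; set A := [:: v; i; a; b].
have [/existsP[x /existsP[y /and3P[xA yA lxy]]]|nolight] :=
  boolP [exists x, exists y, [&& x \in A, y \in A & light x y]].
  by exists x, y.
exfalso; set t := weight D v in t_gt1 wb.
have w_gt1 x y : x \in A -> y \in A -> arc D x y -> (1 < weight D y)%N.
  move=> xA yA xy; rewrite ltn_neqAle weight_gt0 andbT.
  apply: contraNneq nolight => w1; apply/existsP; exists x; apply/existsP; exists y.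
  by rewrite xA yA /light xy -w1.
pose m0 := (arc_mnm D i v + arc_mnm D a b)%MM.
have suppA (m : 'X_{1..n}) x : (m <= m0)%MM -> (0 < m x)%N -> x \in A.
  move=> /mnm_lepP /(_ x) le mx; have {le mx} := leq_trans mx le.
  rewrite !mnmDE !mulmnE !mnm1E !inE ![x == _]eq_sym.
  by do 4![case: eqP => _; rewrite ?orbT //].
have le1 : (arc_mnm D i v <= m0)%MM by apply: lem_addr.
have le2 : (arc_mnm D a b <= m0)%MM by apply: lem_addl.
have d1 : (t.+1 <= mdeg m0)%N by rewrite mdegD mdeg_arc_mnm -/t; exact: leq_addr.
have Q0 : comp_mnm D (pred1 v) t.+1 m0.
  by apply/comp_mnmP; split=> //; exists i, v; split=> //=.
have Q0' : comp_mnm D (predC1 v) t.+1 m0.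
  by apply/comp_mnmP; split=> //; exists a, b; split.
have QP E m : comp_mnm D E t.+1 m -> comp_mnm D predT t.+1 m.
  by case/comp_mnmP=> dm [x [y [xy _ wy le]]]; apply/comp_mnmP; split=> //; exists x, y.
have reg := component_regularity (QP _ _ Q0).
have := @linear_syzygies n K _ _ _ (@degree_component_mnm n K D t.+1) reg
  (comp_mnm D (pred1 v) t.+1) (comp_mnm D (predC1 v) t.+1) m0.
move/(_ _ (QP _) (QP _) (@comp_mnm_up _ _ _ _) (@comp_mnm_up _ _ _ _)
  (@comp_mnm_down _ _ _ _) (@comp_mnm_down _ _ _ _)).
move=> H; apply: (H _ _ m0 (lepm_refl _) Q0 Q0').
  move=> m _ /comp_mnmP[dm [x [y [xy _ wy le]]]]; have [yv|yv] := eqVneq y v.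
    by apply/orP; left; apply/comp_mnmP; split=> //; exists x, y; split=> //=; rewrite yv.
  by apply/orP; right; apply/comp_mnmP; split=> //; exists x, y; split.
move=> m lem0 /comp_mnmP[_ [x [v' [xv /eqP/= v'v _ lex]]]].
rewrite {v'}v'v in xv lex.
case/comp_mnmP=> _ [x' [y [xy yv _ ley]]].
move: (lex) (ley); rewrite !arc_mnm_le // => /andP[mx mv] /andP[mx' my].
have my0 : (0 < m y)%N by apply: leq_trans my; exact: weight_gt0.
have w2 : (1 < m y)%N.
  by apply: leq_trans my; apply: w_gt1 xy; apply: suppA lem0 _.
have xv' : x != v by apply: contraTneq xv => ->; rewrite arc_irr.
have xy' : x' != y by apply: contraTneq xy => ->; rewrite arc_irr.
have [yx|yx] := eqVneq y x.
  have x'v : x' != v.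
    by apply: contraTneq xv => e; apply: arc_asym; rewrite -e -yx.
  apply: leq_trans (_ : mdeg (U_(v) *+ t + U_(x) *+ 2 + U_(x'))%MM <= _)%N.
    by rewrite !mdegD !mdegMn !mdeg1 !mul1n addn2 addn1.
  apply: mdeg_le; apply/mnm_lepP=> z; rewrite !mnmDE !mulmnE !mnm1E.
  rewrite yx in w2 xy'; have [zv|zv] := eqVneq v z.
    by rewrite -zv (negbTE xv') (negbTE x'v) mul1n !addn0.
  have [zx|zx] := eqVneq x z; first by rewrite -zx (negbTE xy').
  by case: (x' =P z) => [<-|].
apply: leq_trans (_ : mdeg (U_(v) *+ t + U_(x) + U_(y) *+ 2)%MM <= _)%N.
  by rewrite !mdegD !mdegMn !mdeg1 !mul1n addn2 addn1.
apply: mdeg_le; apply/mnm_lepP=> z; rewrite !mnmDE !mulmnE !mnm1E.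
have [zv|zv] := eqVneq v z; first by rewrite -zv (negbTE xv') (negbTE yv) mul1n !addn0.
have [zx|zx] := eqVneq x z; first by rewrite -zx (negbTE yx).
by case: (y =P z) => [<-|].
Qed.

Definition heavy_eq x y := (x == y) || heavy x y.

Lemma heavy_eq_uniq a s : path heavy_eq a s -> uniq (a :: s) -> path heavy a s.
Proof.
elim: s a => //= b s IHs a /andP[/predU1P[->|ab] bs] /andP[aN us].
  by rewrite mem_head in aN.
by rewrite ab IHs.
Qed.

(** After removing repetitions from the walk, this is [heavy_cycle] with
    exponent 1: only the last vertex of the walk is heavy to v, so if its pair
    with [a] were light, the pair v, a would be in no triangle. *)
Lemma heavy_chord v a s : path heavy_eq a s -> v \notin a :: s ->
  heavy v a -> heavy v (last a s) ->
  (forall x, x \in s -> x != last a s -> ~~ heavy v x) ->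
  heavy_eq a (last a s).
Proof.
move=> pathH vN Hva; case: (shortenP pathH) => s' path' uniq' sub Hvb far.
apply: contraT; rewrite negb_or => /andP[neq nHab].
have lab : light a (last a s') by move: nHab; rewrite /heavy neq negbK.
case: (@heavy_cycle 1 v a s'); rewrite ?(heavy_eq_uniq path' uniq') //.
- rewrite cons_uniq uniq' andbT; apply: contra vN; rewrite !inE => /predU1P[->|/sub ->].
    by rewrite eqxx.
  by rewrite orbT.
- by apply: contraNneq neq => ->.
- by left.
- move=> x xs'; have [->|ne] := eqVneq x (last a s'); first by constructor 1.
  constructor 2; move: (far x (sub x xs') ne); rewrite negb_and !negbK => /predU1P[e|//].
  by move: vN; rewrite e inE (sub x xs') orbT.
Qed.

(** Each stretch of the walk between successive heavy neighbours of v is closed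
    up by [heavy_chord].  The prefix [s1] is the part of the current stretch
    already read. *)
Lemma heavy_filter v a s1 s2 : path heavy_eq a (s1 ++ s2) -> v \notin a :: s1 ++ s2 ->
  heavy v a -> all (fun x => ~~ heavy v x) s1 ->
  path heavy_eq a (filter (heavy v) s2).
Proof.
elim: s2 s1 a => // x s2 IHs s1 a pathH vN Hva far.
move: pathH vN; rewrite -cat_rcons => pathH vN /=; case: ifP => Hvx; last first.
  by apply: (IHs (rcons s1 x)) => //; rewrite all_rcons Hvx far.
move: pathH vN; rewrite cat_path last_rcons -cat_cons mem_cat negb_or.
case/andP=> path1 path2 /andP[vN1 vN2] /=; apply/andP; split.
  have := @heavy_chord v a (rcons s1 x) path1 vN1 Hva; rewrite last_rcons; apply=> //.
  move=> y; rewrite mem_rcons inE => /predU1P[->|/(allP far)//].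
  by rewrite eqxx.
apply: (IHs [::]) => //=; rewrite inE negb_or vN2 andbT.
by apply: contraNneq vN1 => ->; rewrite inE mem_rcons mem_head orbT.
Qed.

(** The combinatorial heart: v, p, s, q is a hole of the complement in cyclic
    order, and v has the largest weight among the heads of arcs inside it. *)
Lemma no_hole v p s q :
  uniq [:: v, p & rcons s q] -> path heavy p (rcons s q) ->
  ~~ und_adj D v p -> ~~ und_adj D v q -> und_adj D p q ->
  (forall x, x \in s -> und_adj D v x) ->
  (exists2 i, i \in s & arc D i v) ->
  (forall x y, x \in [:: v, p & rcons s q] -> y \in [:: v, p & rcons s q] ->
     arc D x y -> (weight D y <= weight D v)%N) ->
  False.
Proof.
move=> uC pathH nvp nvq pq adjs [i is_ iv] wmax.
move: (uC); rewrite !cons_uniq => /and3P[vN pN uq].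
have qs : q \notin s by move: uq; rewrite rcons_uniq => /andP[].
have [pnq ps] : p != q /\ p \notin s.
  by move: pN; rewrite mem_rcons inE negb_or => /andP[].
have [vp vq vs] : [/\ v != p, v != q & v \notin s].
  by move: vN; rewrite inE mem_rcons inE !negb_or => /and3P[].
have nlight x y : ~~ und_adj D x y -> ~~ light x y.
  by apply: contra => /orP[]/andP[xy _]; rewrite /und_adj xy ?orbT.
have Hvp : heavy v p by rewrite /heavy vp nlight.
have Hvq : heavy v q by rewrite /heavy vq nlight.
have pathE : path heavy_eq p (rcons s q).
  by apply: sub_path pathH => x y Hxy; rewrite /heavy_eq Hxy orbT.
have inC x : x \in s -> x \in [:: v, p & rcons s q].
  by move=> xs; rewrite !inE mem_rcons inE xs !orbT.
have [pC qC vC] : [/\ p \in [:: v, p & rcons s q], q \in [:: v, p & rcons s q]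
    & v \in [:: v, p & rcons s q]].
  by split; rewrite !inE ?mem_rcons ?mem_head ?eqxx ?orbT.
(* If every arc inside the hole has a head of weight 1, its edges of G are
   light, and the hole itself contradicts the chordality of the heavy graph. *)
have [t1|t_gt1] := leqP (weight D v) 1.
  have lightC x y : x \in [:: v, p & rcons s q] -> y \in [:: v, p & rcons s q] ->
      und_adj D x y -> light x y.
    move=> xC yC; rewrite /light; case/orP=> xy; apply/orP; [left|right];
      by rewrite xy eqn_leq weight_gt0 andbT (leq_trans (wmax _ _ _ _ xy)).
  have := heavy_chord pathE vN Hvp; rewrite last_rcons => /(_ Hvq).
  case/(_ _)/orP; last by rewrite /heavy (lightC p q) ?andbF.
    move=> x; rewrite mem_rcons inE => /predU1P[->|xs _]; first by rewrite eqxx.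
    by rewrite /heavy lightC ?andbF // ?inC // adjs.
  by rewrite (negbTE pnq).
have in_heavy x : arc D x v -> ~~ light v x.
  move=> xv; rewrite /light xv (negbTE (arc_asym xv)) /=.
  by rewrite gtn_eqF.
set f := filter (heavy v) s.
have fs x : x \in f -> x \in s by rewrite mem_filter => /andP[].
have pathf : path heavy_eq p (rcons f q).
  have := heavy_filter (s1 := [::]) pathE vN Hvp isT.
  by rewrite filter_rcons Hvq.
(* A heavy pair never joins an in-neighbour of v to an out-neighbour. *)
have classf x y : x \in f -> y \in f -> heavy x y -> arc D x v -> arc D y v.
  move=> xf yf Hxy xv; have /orP[vy|//] := adjs y (fs y yf).
  have [|x' [y' [x'A y'A]]] := light_arc xv t_gt1 vy _ (wmax _ _ vC (inC y (fs y yf)) vy).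
    by apply: contraTneq (fs y yf) => ->.
  have /andP[_ /negbTE nvy] : heavy v y by move: yf; rewrite mem_filter => /andP[].
  have /negbTE nvx := in_heavy x xv; have /andP[_ /negbTE nxy] := Hxy.
  move: x'A y'A; rewrite !inE => /or4P[]/eqP-> /or4P[]/eqP->;
    by rewrite ?light_irr ?nvx ?nvy ?nxy // light_sym ?nvx ?nvy ?nxy.
have iF : i \in f.
  by rewrite mem_filter is_ /heavy in_heavy // !andbT; apply: contraNneq vs => ->.
have [j [f1 fE]] : exists j f1, f = j :: f1 by case: (f) iF => // j f1; exists j, f1.
have all_in x : x \in f -> arc D x v.
  pose same : rel 'I_n := fun x y => arc D x v == arc D y v.
  have same_tr : transitive same by move=> x1 x2 x3 /eqP e1 /eqP e2; rewrite /same e1 e2.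
  have : path same j f1.
    move: pathf; rewrite fE /= rcons_path => /and3P[_ pathf1 _].
    apply: (sub_in_path (P := mem f)) pathf1; last by rewrite fE; apply/allP.
    move=> x1 x2 x1f x2f /predU1P[->|H12]; rewrite /same //.
    apply/eqP; apply/idP/idP; first exact: classf.
    by apply: classf => //; rewrite heavy_sym.
  move/(order_path_min same_tr)/allP => samej xf.
  have samej' y : y \in f -> same j y.
    by rewrite fE inE => /predU1P[->|/samej //]; rewrite /same.
  by have /eqP <- := samej' x xf; have /eqP -> := samej' i iF.
(* If p, q is heavy, closing the walk by p yields [a], heavy to both p and q. *)
have [Hpq|nHpq] := boolP (heavy p q).
  have jf : j \in f by rewrite fE mem_head.
  have Hpj : heavy p j.
    move: pathf; rewrite fE /= => /andP[/predU1P[e|//] _].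
    by move: ps; rewrite e (fs j jf).
  have pathj : path heavy_eq j (rcons f1 q) by move: pathf; rewrite fE => /andP[].
  have pNf : p \notin j :: rcons f1 q.
    rewrite -rcons_cons -fE mem_rcons inE negb_or pnq.
    by apply: contra ps => /fs.
  have := heavy_filter (s1 := [::]) pathj pNf Hpj isT.
  rewrite filter_rcons Hpq rcons_path => /andP[_].
  set a := last j _ => Haq.
  have /andP[Hpa af] : heavy p a && (a \in f).
    have : a \in j :: filter (heavy p) f1 by exact: mem_last.
    rewrite inE => /predU1P[->|]; first by rewrite Hpj.
    by rewrite mem_filter fE inE => /andP[-> ->]; rewrite orbT.
  have {}Haq : heavy a q.
    by case/predU1P: Haq => // e; move: qs; rewrite -e (fs a af).
  have [x [y [xpq ypq xy]]] : exists x y, [/\ x \in [:: p; q], y \in [:: p; q] & arc D x y].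
    by case/orP: pq => e; [exists p, q | exists q, p]; rewrite !inE !eqxx orbT.
  have pqC z : z \in [:: p; q] -> z \in [:: v, p & rcons s q] by rewrite !inE => /orP[]/eqP->.
  have [|x' [y' [x'A y'A]]] :=
    light_arc (all_in a af) t_gt1 xy _ (wmax _ _ (pqC _ xpq) (pqC _ ypq) xy).
    by move: ypq; rewrite !inE => /orP[]/eqP->; rewrite eq_sym.
  have subA z : z \in [:: v; a; x; y] -> [\/ z = v, z = a, z = p | z = q].
    move: xpq ypq; rewrite !inE => /orP[]/eqP-> /orP[]/eqP-> /or4P[]/eqP->; by constructor.
  have /andP[_ /negbTE nvp'] := Hvp; have /andP[_ /negbTE nvq'] := Hvq.
  have /andP[_ /negbTE npq'] := Hpq; have /andP[_ /negbTE npa'] := Hpa.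
  have /andP[_ /negbTE naq'] := Haq; have /negbTE nva' := in_heavy a (all_in a af).
  by case: (subA x' x'A) => ->; case: (subA y' y'A) => ->;
    rewrite ?light_irr ?nvp' ?nvq' ?npq' ?npa' ?naq' ?nva' // light_sym
            ?nvp' ?nvq' ?npq' ?npa' ?naq' ?nva'.
have lpq : light p q by move: nHpq; rewrite /heavy pnq negbK.
have := last_rcons p f q; case: (shortenP pathf) => s' path' uniq' sub lastE.
have noarc x : ~~ und_adj D v x -> ~~ arc D x v /\ ~~ arc D v x.
  by rewrite negb_or => /andP[].
have [nap nva] := noarc p nvp; have [naq nvaq] := noarc q nvq.
case: (@heavy_cycle (weight D v) v p s'); rewrite ?lastE ?(heavy_eq_uniq path' uniq') //.
- rewrite cons_uniq uniq' andbT inE negb_or vp; apply: contra vs => /sub.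
  by rewrite mem_rcons inE (negbTE vq) => /fs.
- by apply: contraNneq pnq => e; rewrite e in lastE; rewrite -lastE.
- right; split=> // x; rewrite inE => /predU1P[->|/sub]; first by rewrite (negbTE nva).
  rewrite mem_rcons inE => /predU1P[->|/all_in xv]; first by rewrite (negbTE nvaq).
  by rewrite (negbTE (arc_asym xv)).
- move=> x /sub; rewrite mem_rcons inE => /predU1P[->|/all_in xv].
    by constructor 1.
  by constructor 3.
Qed.

End ComponentwiseLinear.

(** * Unrolling a hole *)
Lemma val_iter_ordS k (i : 'I_k) j : val (iter j (@ordS k) i) = ((i + j) %% k)%N.
Proof.
elim: j => [|j IHj]; first by rewrite addn0 modn_small.
by rewrite iterS /= IHj -addn1 modnDml addn1 -addnS.
Qed.

Lemma iter_ordS_inj k (i : 'I_k) j l : (j < k)%N -> (l < k)%N ->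
  iter j (@ordS k) i = iter l (@ordS k) i -> j = l.
Proof.
move=> jk lk /(congr1 val); rewrite !val_iter_ordS => /eqP.
by rewrite eqn_modDl !modn_small // => /eqP.
Qed.

Lemma path_map_iota (T : Type) (e : rel T) (g : nat -> T) a m :
  (forall j, e (g j) (g j.+1)) -> path e (g a) (map g (iota a.+1 m)).
Proof. by move=> eg; elim: m a => //= m IHm a; rewrite eg IHm. Qed.

Unset Implicit Arguments.

Theorem theorem3p8 (K : fieldType) (n : nat) (D : wograph n) :
  componentwise_linear (@edge_ideal K n D) ->
  chordal (compl_graph (underlying D)).
Proof.
move=> cwl k c k_gt3 [injc adjc].
have cyc i j : (c i != c j) && ~~ und_adj D (c i) (c j) = (j == ordS i) || (i == ordS j).
  exact: adjc.
have k_gt0 : (0 < k)%N by apply: leq_trans k_gt3.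
pose P (i : 'I_k) := [exists j, arc D (c j) (c i)].
pose i1 := Ordinal k_gt0.
have ne02 : i1 != iter 2 (@ordS k) i1.
  by apply/eqP => /(@iter_ordS_inj k i1 0 2 k_gt0 (ltnW k_gt3)).
have [i0 Pi0] : exists i, P i.
  have := cyc i1 (iter 2 (@ordS k) i1).
  rewrite (inj_eq injc) ne02 /=.
  have -> : (iter 2 (@ordS k) i1 == iter 1 (@ordS k) i1) = false.
    by apply/eqP => /(@iter_ordS_inj k i1 2 1); lia.
  have -> : (i1 == ordS (iter 2 (@ordS k) i1)) = false.
    by apply/eqP => /(@iter_ordS_inj k i1 0 3); lia.
  move/negbFE/orP=> [a|a]; [exists (iter 2 (@ordS k) i1)|exists i1]; apply/existsP;
    [by exists i1|by exists (iter 2 (@ordS k) i1)].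
(* The apex of the hole: a head of maximal weight. *)
case: (@arg_maxnP _ i0 P (fun i => weight D (c i)) Pi0) => u /existsP[w wu] umax.
pose z j := iter j (@ordS k) u; pose g j := c (z j).
have zinj j l : (j < k)%N -> (l < k)%N -> z j = z l -> j = l by apply: iter_ordS_inj.
have zk : z k = u.
  by apply: val_inj; rewrite val_iter_ordS modnDr modn_small.
have g_compl j : (g j != g j.+1) && ~~ und_adj D (g j) (g j.+1) by rewrite cyc eqxx.
have g_und j l : (j < l < k)%N -> (l != j.+1) -> (j != 0%N) || (l.+1 != k) ->
    und_adj D (g j) (g l).
  move=> /andP[jl lk] lj jl'; have := cyc (z j) (z l).
  rewrite (inj_eq injc); case: (z j =P z l) => [/zinj|_ /=]; first lia.
  have -> : (z l == ordS (z j)) = false.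
    by apply/eqP => /(zinj l j.+1 lk (leq_ltn_trans jl lk)) e; rewrite e eqxx in lj.
  have -> : (z j == ordS (z l)) = false; last by move/negbFE.
  apply/eqP => e; have [lt|ge] := ltnP l.+1 k.
    by have := zinj j l.+1 (ltn_trans jl lk) lt e; lia.
  have kE : l.+1 = k by lia.
  have j0 : j = 0%N by apply: zinj; [lia|lia|rewrite e -[ordS _]/(z l.+1) kE zk].
  by rewrite j0 kE !eqxx in jl'.
pose s := map g (iota 2 (k - 3)); pose q := g k.-1.
have sq : rcons s q = map g (iota 2 (k - 2)).
  have -> : (k - 2 = (k - 3) + 1)%N by lia.
  rewrite iotaD map_cat -cats1; congr (_ ++ _) => /=.
  by congr [:: g _]; lia.
have CE : [:: g 0%N, g 1%N & rcons s q] = map g (iota 0 k).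
  by rewrite sq -[in RHS](subnKC (ltnW (ltnW k_gt3))).
have sP x : x \in s -> exists2 j, (1 < j < k.-1)%N & x = g j.
  by case/mapP=> j; rewrite mem_iota => jk ->; exists j => //; lia.
have CP x : x \in [:: g 0%N, g 1%N & rcons s q] -> exists i, x = c i.
  by rewrite CE => /mapP[j _ ->]; exists (z j).
(* The witness is the number of steps from u to i around the hole. *)
have zsurj i : c i \in [:: g 0%N, g 1%N & rcons s q].
  rewrite CE; apply/mapP; exists ((i + (k - u)) %% k)%N.
    by rewrite mem_iota /= add0n ltn_mod.
  congr c; apply: val_inj; rewrite val_iter_ordS modnDmr addnCA subnKC; last exact: ltnW.
  by rewrite modnDr modn_small.
have uC : uniq [:: g 0%N, g 1%N & rcons s q].
  rewrite CE map_inj_in_uniq ?iota_uniq // => j l.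
  by rewrite !mem_iota => /andP[_ jk] /andP[_ lk] /injc; apply: zinj.
have nadj01 : ~~ und_adj D (g 0%N) (g 1%N) by have /andP[] := g_compl 0%N.
have nadj0q : ~~ und_adj D (g 0%N) q.
  have := g_compl k.-1; rewrite prednK // /g zk => /andP[_].
  by rewrite und_adj_sym.
apply: (@no_hole n K D cwl (g 0%N) (g 1%N) s q) => //.
- rewrite sq; apply: path_map_iota => j; have /andP[ne nadj] := g_compl j.
  by rewrite /heavy ne; apply: contra nadj => /orP[]/andP[h _]; rewrite /und_adj h ?orbT.
- by apply: g_und; lia.
- by move=> x /sP[j jk ->]; apply: g_und; lia.
- have := zsurj w; rewrite !inE mem_rcons inE => /or4P[/eqP e|/eqP e|/eqP e|ws].
  + by move: wu; rewrite e arc_irr.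
  + by move: nadj01; rewrite /und_adj -e wu orbT.
  + by move: nadj0q; rewrite /und_adj -e wu orbT.
  + by exists (c w).
- move=> x y /CP[i ->] /CP[j ->] ij; apply: umax.
  by apply/existsP; exists i.
Qed.
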